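(* Let $d\ge 2$, let $v_1,\ldots,v_d\in\mathbb{R}^d$ be linearly independent, let $\Sigma=\{x_1v_1+\cdots+x_dv_d:\ x_1,\ldots,x_d\ge 0\}$, and let $m\ge 2$. (i) For Lebesgue-a.e. $\mathcal{A}\in\mathcal{X}_{\Sigma,m}$, the $m$-tuple $\mathcal{A}$ is strongly Diophantine. In particular, Lebesgue-a.e. $m$-tuple of $GL_d(\mathbb{R})$ matrices with all entries positive is strongly Diophantine. (ii) For a.e. $\mathcal{A}\in\mathcal{Y}_{\Sigma,m}$ (with respect to the smooth measure on this $(d^2-1)m$-dimensional manifold), the $m$-tuple $\mathcal{A}$ is strongly Diophantine. In particular, a.e. $m$-tuple of $SL_d(\mathbb{R})$ matrices with all entries positive is strongly Diophantine.
   Context: A matrix $A\in GL_d(\mathbb{R})$ is said to strictly preserve (have strictly invariant) the cone $\Sigma$ if $A(\Sigma\setminus\{0\})\subset\Sigma^\circ$ (the interior of $\Sigma$). $\mathcal{X}_{\Sigma,m}$ denotes the set of $m$-tuples of $GL_d(\mathbb{R})$ matrices each of which strictly preserves $\Sigma$, viewed as an open subset of $\mathbb{R}^{d^2m}$; $\mathcal{Y}_{\Sigma,m}$ is the set of such $m$-tuples of $SL_d(\mathbb{R})$ matrices, viewed as a $(d^2-1)m$-dimensional manifold. For a finite family $\mathcal{A}=\{A_i\}_{i\in\Lambda}$ and a word $\mathbf{i}=i_1\ldots i_n\in\Lambda^n$, write $A_{\mathbf{i}}=A_{i_1}\cdots A_{i_n}$. The family is strongly Diophantine if there is $c>0$ such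 that for all $n\in\mathbb{N}$ and all $\mathbf{i}\ne\mathbf{j}$ in $\Lambda^n$, $\|A_{\mathbf{i}}-A_{\mathbf{j}}\|>c^n$ (operator norm). *)

(* Defs.v *)
From HB Require Import structures.
From mathcomp Require Import all_boot all_order all_algebra.
From mathcomp Require Import all_classical all_reals all_analysis.
Set Implicit Arguments. Unset Strict Implicit. Unset Printing Implicit Defensive.
Import Order.TTheory GRing.Theory Num.Theory numFieldNormedType.Exports.
Local Open Scope classical_set_scope.
Local Open Scope ring_scope.

Section Defs.
Variable R : realType.

Definition eucl_norm (d : nat) (x : 'cV[R]_d) : R :=
  Num.sqrt (\sum_(i < d) x i 0 ^+ 2).

Definition op_norm (d : nat) (A : 'M[R]_d) : R :=
  sup [set r | exists x : 'cV[R]_d, eucl_norm x = 1 /\ r = eucl_norm (A *m x)].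

Definition word_prod (d m n : nat) (A : 'I_m -> 'M[R]_d) (w : 'I_n -> 'I_m)
  : 'M[R]_d := \big[mulmx/1%:M]_(k < n) A (w k).

Definition strongly_diophantine (d m : nat) (A : 'I_m -> 'M[R]_d) : Prop :=
  exists c : R, 0 < c /\
    forall (n : nat) (w1 w2 : 'I_n -> 'I_m), w1 <> w2 ->
      op_norm (word_prod A w1 - word_prod A w2) > c ^+ n.

Definition cone (d : nat) (V : 'M[R]_d) : set 'cV[R]_d :=
  [set y | exists x : 'cV[R]_d, (forall i, 0 <= x i 0) /\ y = V *m x].

Definition strictly_preserves (d : nat) (S : set 'cV[R]_d) (A : 'M[R]_d) : Prop :=
  forall y, S y -> y <> 0 -> interior S (A *m y).

(* An m-tuple of d x d matrices is coded as a point of R^{m d^2} = 'M_(m, d*d):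
   row i is the vectorisation of A_i. *)
Definition tup (d m : nat) (M : 'M[R]_(m, d * d)) : 'I_m -> 'M[R]_d :=
  fun i => vec_mx (row i M).

(* Lebesgue null sets in R^{p q} = 'M_(p,q): coverable by countably many
   boxes of arbitrarily small total volume. *)
Definition box (p q : nat) (a b : 'M[R]_(p, q)) : set 'M[R]_(p, q) :=
  [set x | forall i j, a i j <= x i j <= b i j].

Definition box_vol (p q : nat) (a b : 'M[R]_(p, q)) : R :=
  \prod_(i < p) \prod_(j < q) (b i j - a i j).

Definition leb_null (p q : nat) (E : set 'M[R]_(p, q)) : Prop :=
  forall eps : R, 0 < eps -> exists a b : nat -> 'M[R]_(p, q),
    (forall k i j, a k i j <= b k i j) /\
    E `<=` \bigcup_k box (a k) (b k) /\
    (forall N, \sum_(k < N) box_vol (a k) (b k) <= eps).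

Definition Xset (d m : nat) (V : 'M[R]_d) : set 'M[R]_(m, d * d) :=
  [set M | forall i, tup M i \in unitmx /\ strictly_preserves (cone V) (tup M i)].

Definition SLm (d m : nat) : set 'M[R]_(m, d * d) :=
  [set M | forall i, \det (tup M i) = 1].

Definition Yset (d m : nat) (V : 'M[R]_d) : set 'M[R]_(m, d * d) :=
  [set M | forall i, \det (tup M i) = 1 /\ strictly_preserves (cone V) (tup M i)].

(* Null sets for the smooth measure class on the (d^2-1)m-dimensional
   manifold SL_d(R)^m: E is null iff its preimage under every C^1 immersion
   phi : U -> SL_d(R)^m (U open in R^{(d^2-1)m}) is Lebesgue null.  Such
   immersions are exactly the local C^1 parametrisations (inverse charts). *)
Definition SL_null (d m : nat) (E : set 'M[R]_(m, d * d)) : Prop :=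
  forall (U : set 'rV[R]_((d * d).-1 * m))
         (phi : 'rV[R]_((d * d).-1 * m) -> 'M[R]_(m, d * d)),
    open U ->
    (forall u, U u -> SLm (phi u)) ->
    (forall u, U u -> differentiable phi u /\ injective ('d phi u)) ->
    (forall v, {in U, continuous ('D_v phi)}) ->
    leb_null (U `&` phi @^-1` E).

End Defs.

(* Main.v *)
(* Words are compared through the direction of the image of a positive vector:
   for positive tuples B, let slope_w(B) be the quotient of two coordinates of
   B_w (1,...,1).  After cancelling a common prefix it suffices that, for
   almost every B, |slope_u(B) - slope_v(B)| > c^n for all words u, v of length
   n with different first letters.  Along the lines B + t P, with P_k of rank
   one and image of slope k+1, the gap f(t) = slope_u - slope_v is at least 1/2
   for large t, and since positive matrices contract the cone its divided
   differences are bounded by C r^(-j), uniformly in the two words.  These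
   bounds propagate the lower bound back along the line and give transversality
   of a uniform finite order: {|f| <= kappa lam^N} contains no N points of
   [0,r] that are lam-separated.  By Fubini (counted on a grid) the set
   {|gap| <= c^n} has measure at most C theta^n, with theta small as c is small,
   which beats the m^(2n) pairs of words.  Slopes do not change when the
   matrices are rescaled, so the bounds pass to parametrised pieces of SL_d^m
   after adding the m scaling parameters. *)
Require Import Defs.
From HB Require Import structures.
From mathcomp Require Import all_boot all_order all_algebra.
From mathcomp Require Import all_classical all_reals all_analysis.
From mathcomp Require Import perm ring lra zify.
Set Implicit Arguments. Unset Strict Implicit. Unset Printing Implicit Defensive.
Import Order.TTheory GRing.Theory Num.Theory numFieldNormedType.Exports.
Local Open Scope ring_scope.

(** * Divided differences *)

Section DividedDifferences.
Variable R : realFieldType.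
Implicit Types (f g p : R -> R) (x : nat -> R).

(** The obstacle is that words have unbounded length, so no regularity bound may depend on the word.
    Regularity along a line is therefore measured by a submultiplicative norm of divided
    differences, an algebraic substitute for the sup norm on a complex disc of radius [rho]. The
    bound is proved letter by letter, and the induction closes because averaging by a positive
    matrix contracts oscillations by more than a short step along the line creates. Choosing [rho]
    as twice the length [r] of the interval makes the last term of Newton interpolation of size
    2^-N, so one N serves all words. The Lipschitz constants of the gaps in the matrix entries do
    depend on the length n, but they only decide how fine the grid must be, and the grid is chosen
    after n. Counting grid cells bounds separated families, and maximal separated families are
    centres of finite box covers, the form in which null sets are defined. *)

Fixpoint dd f (n : nat) x : R :=
  if n is n'.+1 then
    (dd f n' (fun i => x i.+1) - dd f n' x) / (x n - x 0%N)
  else f (x 0%N).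

Lemma eq_dd f g n x : (forall i, (i <= n)%N -> f (x i) = g (x i)) ->
  dd f n x = dd g n x.
Proof.
elim: n x => [|n IH] x h /=; first exact: h.
by rewrite !IH // => i hi; apply: h; lia.
Qed.

Lemma eq_dd_pts f n x y : (forall i, (i <= n)%N -> x i = y i) ->
  dd f n x = dd f n y.
Proof.
elim: n x y => [|n IH] x y h /=; first by rewrite h.
rewrite (IH (fun i => x i.+1) (fun i => y i.+1)); last by move=> i hi; apply: h; lia.
rewrite (IH x y); last by move=> i hi; apply: h; lia.
by rewrite !h.
Qed.

Lemma ddD f g n x : dd (fun t => f t + g t) n x = dd f n x + dd g n x.
Proof. by elim: n x => [|n IH] x //=; rewrite !IH; ring. Qed.

Lemma ddZ c f n x : dd (fun t => c * f t) n x = c * dd f n x.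
Proof. by elim: n x => [|n IH] x //=; rewrite !IH; ring. Qed.

Lemma dd_cst c n x : dd (fun=> c) n x = if n is 0 then c else 0.
Proof.
elim: n x => [|n IH] x //.
by rewrite [LHS]/= !IH; case: n {IH} => [|n]; rewrite subrr mul0r.
Qed.

Definition distinct_upto n x := forall i j, (i < j <= n)%N -> x j != x i.

Lemma distinct_upto_S n x : distinct_upto n.+1 x ->
  distinct_upto n x /\ distinct_upto n (fun i => x i.+1).
Proof. by move=> h; split=> i j hij; apply: h; lia. Qed.

Lemma dd_rec f n x : x n.+1 != x 0%N ->
  dd f n (fun i => x i.+1) = dd f n x + (x n.+1 - x 0%N) * dd f n.+1 x.
Proof.
move=> h /=; rewrite mulrC divfK; first by ring.
by rewrite subr_eq0.
Qed.

Lemma dd_id n x : distinct_upto n x ->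
  dd id n x = if n is 0 then x 0%N else (n == 1)%:R.
Proof.
elim: n x => [|n IH] x h //.
have [h1 h2] := distinct_upto_S h.
have nz : x n.+1 - x 0%N != 0 by rewrite subr_eq0 h //= leqnn.
rewrite [LHS]/= !IH //; case: n h {IH h1 h2} nz => [|n] h nz /=.
  by rewrite divff.
by rewrite subrr mul0r.
Qed.

(** In the difference of the sums for the shifted and unshifted nodes, [dd_rec] is applied to f in
    the first and to g in the second. The common products cancel, and the weights x_j - x_0 and
    x_(n+1) - x_j that remain add up to x_(n+1) - x_0. *)
Lemma dd_leibniz f g n x : distinct_upto n x ->
  dd (fun t => f t * g t) n x =
  \sum_(j < n.+1) dd f j x * dd g (n - j) (fun i => x (j + i)%N).
Proof.
elim: n x => [|n IH] x h; first by rewrite big_ord1 /=.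
have [h1 h2] := distinct_upto_S h.
have nz : x n.+1 - x 0%N != 0 by rewrite subr_eq0 h //= leqnn.
apply: (mulIf nz); rewrite [LHS]/= divfK // (IH _ h2) (IH _ h1).
pose G j := dd g (n.+1 - j) (fun i => x (j + i)%N).
pose Fj j := dd f j x.
have e1 (j : 'I_n.+1) : dd f j (fun i => x i.+1) *
    dd g (n - j) (fun i => x (j + i).+1) =
   Fj j * G j.+1 + (x j.+1 - x 0%N) * Fj j.+1 * G j.+1.
  rewrite (dd_rec f (n := j) (x := x)); last by apply: h; have := ltn_ord j; lia.
  rewrite /Fj /G subSS.
  rewrite (@eq_dd_pts g (n - j) (fun i => x (j + i).+1) (fun i => x (j.+1 + i)%N)) //.
  ring.
have e2 (j : 'I_n.+1) : dd f j x * dd g (n - j) (fun i => x (j + i)%N) =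
   Fj j * G j.+1 - (x n.+1 - x j) * Fj j * G j.
  have ej : (n.+1 - j = (n - j).+1)%N by have := ltn_ord j; lia.
  have := @dd_rec g (n - j) (fun i => x (j + i)%N).
  rewrite -ej (_ : (j + (n.+1 - j) = n.+1)%N); last by have := ltn_ord j; lia.
  rewrite addn0 => E.
  have {E}E := E (h _ _ _).
  rewrite /Fj /G subSS.
  rewrite (@eq_dd_pts g (n - j) (fun i => x (j.+1 + i)%N) (fun i => x (j + i.+1)%N)); last first.
    by move=> i _; congr x; lia.
  rewrite E; first by ring.
  by have := ltn_ord j; lia.
rewrite (eq_bigr _ (fun j _ => e1 j)) [X in _ - X](eq_bigr _ (fun j _ => e2 j)).
rewrite big_split sumrB /= mulr_suml.
rewrite [RHS](eq_bigr (fun j : 'I_n.+2 => (x j - x 0%N) * Fj j * G j +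
   (x n.+1 - x j) * Fj j * G j)); last by move=> j _; rewrite /Fj /G; ring.
rewrite big_split /= [X in _ = X + _]big_ord_recl [X in _ = _ + X]big_ord_recr /=.
rewrite !subrr !mul0r add0r addr0.
under [X in _ = X + _]eq_bigr => j _ do rewrite /bump /= add1n.
ring.
Qed.

(** Induction on the shifted nodes: [dd_rec] turns their expansion into the wanted one plus a
    telescoping sum, whose top term vanishes because it contains the factor x_(n+1) - x_(n+1). *)
Lemma newton_interpolation f n x : distinct_upto n x ->
  f (x n) = \sum_(j < n.+1) dd f j x * \prod_(i < j) (x n - x i).
Proof.
elim: n x => [|n IH] x h; first by rewrite big_ord1 /= big_ord0 mulr1.
have [h1 h2] := distinct_upto_S h.
rewrite (IH _ h2) /=.
pose Q j := \prod_(i < j) (x n.+1 - x i.+1).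
rewrite (eq_bigr (fun j : 'I_n.+1 => (x n.+1 - x 0%N) * Q j * dd f j.+1 x -
    (Q j.+1 * dd f j.+1 x - Q j * dd f j x))); last first.
  move=> j _; rewrite (dd_rec f (n := j) (x := x)); last first.
    by apply: h; have := ltn_ord j; lia.
  by rewrite /Q big_ord_recr /=; ring.
rewrite sumrB -(big_mkord xpredT (fun j => Q j.+1 * dd f j.+1 x - Q j * dd f j x)).
rewrite telescope_sumr // [RHS]big_ord_recl big_ord0 mulr1 /= addrC.
rewrite {1}/Q big_ord_recr /= subrr mulr0 mul0r sub0r opprK /Q big_ord0 mul1r.
congr (_ + _); apply: eq_bigr => j _.
by rewrite /bump /= add1n big_ord_recl /= mulrC.
Qed.

Lemma dd_small f n x (e lam : R) : 0 < lam -> 0 <= e ->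
  (forall i j, (i < j <= n)%N -> lam <= x j - x i) ->
  (forall i, (i <= n)%N -> `|f (x i)| <= e) ->
  `|dd f n x| <= (2 / lam) ^+ n * e.
Proof.
move=> l0 e0; elim: n x => [|n IH] x hx hf; first by rewrite expr0 mul1r; apply: hf.
have H1 : `|dd f n x| <= (2 / lam) ^+ n * e.
  by apply: IH => [i j hij|i hi]; [apply: hx; lia|apply: hf; lia].
have H2 : `|dd f n (fun i => x i.+1)| <= (2 / lam) ^+ n * e.
  by apply: IH => [i j hij|i hi]; [apply: hx; lia|apply: hf; lia].
have H3 : lam <= x n.+1 - x 0%N by apply: hx; lia.
have -> : (2 / lam) ^+ n.+1 * e = 2 * ((2 / lam) ^+ n * e) * lam^-1.
  by rewrite exprS; ring.
rewrite /= normrM normfV.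
apply: ler_pM; rewrite ?invr_ge0 //.
  by apply: le_trans (ler_normB _ _) _; rewrite mulr_natl mulr2n lerD.
have H4 := le_trans H3 (ler_norm _).
by rewrite lef_pV2 ?posrE // (lt_le_trans l0 H4).
Qed.

(** * A submultiplicative norm built from divided differences *)

Section Norm.
Variables (N : nat) (x : nat -> R) (rho : R).
Hypothesis rho0 : 0 < rho.
Hypothesis xD : distinct_upto N x.

Let row f (i : nat) : R :=
  \sum_(j < (N - i).+1) `|dd f j (fun k => x (i + k)%N)| * rho ^+ j.

(* The maximal absolute row sum of the upper triangular matrix with entries
   [f[x_i..x_j] rho^(j-i)]; the Leibniz rule says that this matrix is
   multiplicative in f, whence submultiplicativity. *)
Definition ddnorm f : R := \big[Num.max/0]_(i < N.+1) row f i.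

Let row_ge0 f i : 0 <= row f i.
Proof. by apply: sumr_ge0 => j _; rewrite mulr_ge0 // exprn_ge0 // ltW. Qed.

Let shiftD i : (i <= N)%N -> forall n, (n <= N - i)%N -> distinct_upto n (fun k => x (i + k)%N).
Proof. by move=> hi n hn a b hab; apply: xD; lia. Qed.

Lemma ddnorm_ge0 f : 0 <= ddnorm f.
Proof. by rewrite /ddnorm; elim/big_ind: _ => // a b ha hb; rewrite le_max ha. Qed.

Let row_le f i : (i <= N)%N -> row f i <= ddnorm f.
Proof.
move=> hi; have hi' : (i < N.+1)%N by [].
rewrite /ddnorm (bigD1 (Ordinal hi')) //= le_max lexx //.
Qed.

Let ddnorm_le f B : 0 <= B -> (forall i, (i <= N)%N -> row f i <= B) -> ddnorm f <= B.
Proof.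
move=> B0 h; rewrite /ddnorm; elim/big_ind: _ => // [a b ha hb|i _].
  by rewrite ge_max ha.
by apply: h; have := ltn_ord i; lia.
Qed.

Lemma eq_ddnorm f g : (forall i, (i <= N)%N -> f (x i) = g (x i)) -> ddnorm f = ddnorm g.
Proof.
move=> h; apply: eq_bigr => i _; apply: eq_bigr => j _.
congr (`|_| * _); apply: eq_dd => k hk; apply: h.
by have := ltn_ord i; have := ltn_ord j; lia.
Qed.

Lemma ddnormD f g : ddnorm (fun t => f t + g t) <= ddnorm f + ddnorm g.
Proof.
apply: ddnorm_le => [|i hi]; first by rewrite addr_ge0 // ddnorm_ge0.
apply: le_trans (lerD (row_le f hi) (row_le g hi)).
rewrite /row -big_split /=; apply: ler_sum => j _.
by rewrite -mulrDl ddD ler_wpM2r ?ler_normD // exprn_ge0 // ltW.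
Qed.

Lemma ddnormZ c f : ddnorm (fun t => c * f t) <= `|c| * ddnorm f.
Proof.
apply: ddnorm_le => [|i hi]; first by rewrite mulr_ge0 // ddnorm_ge0.
apply: le_trans (ler_wpM2l _ (row_le f hi)) => //.
rewrite /row mulr_sumr; apply: ler_sum => j _.
by rewrite ddZ normrM mulrA.
Qed.

Lemma ddnorm_cst c : ddnorm (fun=> c) <= `|c|.
Proof.
apply: ddnorm_le => [|i hi] //; rewrite /row.
rewrite big_ord_recl big1 => [|j _]; first by rewrite /= expr0 mulr1 addr0.
by rewrite dd_cst /= normr0 mul0r.
Qed.

Lemma ddnorm_sum (I : Type) (s : seq I) (f : I -> R -> R) :
  ddnorm (fun t => \sum_(i <- s) f i t) <= \sum_(i <- s) ddnorm (f i).
Proof.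
elim: s => [|i s IH].
  rewrite big_nil (eq_ddnorm (g := fun=> 0)); last by move=> i _; rewrite big_nil.
  by apply: le_trans (ddnorm_cst 0) _; rewrite normr0.
rewrite big_cons (eq_ddnorm (g := fun t => f i t + \sum_(j <- s) f j t)); last first.
  by move=> k _; rewrite big_cons.
by apply: le_trans (ddnormD _ _) _; rewrite lerD.
Qed.

Lemma ddnormM f g : ddnorm (fun t => f t * g t) <= ddnorm f * ddnorm g.
Proof.
apply: ddnorm_le => [|i hi]; first by rewrite mulr_ge0 // ddnorm_ge0.
have -> : row (fun t => f t * g t) i = \sum_(n < (N - i).+1)
   `|\sum_(j < n.+1) dd f j (fun k => x (i + k)%N) *
      dd g (n - j) (fun k => x (i + (j + k))%N)| * rho ^+ n.
  apply: eq_bigr => n _; congr (`|_| * _); rewrite dd_leibniz //.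
  by apply: shiftD => //; have := ltn_ord n; lia.
pose c j l := `|dd f j (fun k => x (i + k)%N)| * rho ^+ j *
   (`|dd g l (fun k => x (i + j + k)%N)| * rho ^+ l).
have c0 j l : 0 <= c j l by rewrite !mulr_ge0 // exprn_ge0 // ltW.
apply: (@le_trans _ _ (\sum_(n < (N - i).+1) \sum_(j < (N - i).+1 | (j <= n)%N) c j (n - j)%N)).
  apply: ler_sum => n _.
  rewrite -(big_mkord (fun j => (j <= n)%N) (fun j => c j (n - j)%N)).
  rewrite (big_cat_nat (n := n.+1)) //=.
  rewrite [X in _ <= _ + X]big1_seq ?addr0; last first.
    by move=> j /andP[hj]; rewrite mem_index_iota; lia.
  rewrite [leRHS]big_mkcond [leRHS]big_mkord /=.
  apply: (@le_trans _ _ (\sum_(j < n.+1) c j (n - j)%N)); last first.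
    by apply: ler_sum => j _; have -> : (j <= n)%N by have := ltn_ord j; lia.
  apply: le_trans (ler_wpM2r _ (ler_norm_sum _ _ _)) _; first by rewrite exprn_ge0 // ltW.
  rewrite mulr_suml; apply: ler_sum => j _; rewrite /c normrM.
  have -> : rho ^+ n = rho ^+ j * rho ^+ (n - j) by rewrite -exprD subnKC //; have := ltn_ord j; lia.
  rewrite (@eq_dd_pts g _ (fun k => x (i + (j + k))%N) (fun k => x (i + j + k)%N)) => [|k _].
    by rewrite le_eqVlt; apply/orP; left; apply/eqP; ring.
  by rewrite addnA.
(* For fixed j the sum over n is the row of g that starts at node i + j, which [ddnorm g] bounds. *)
rewrite (exchange_big_dep xpredT) //=.
apply: le_trans (ler_wpM2r (ddnorm_ge0 g) (row_le f hi)).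
rewrite /row mulr_suml; apply: ler_sum => j _.
have hij : (i + j <= N)%N by have := ltn_ord j; lia.
apply: le_trans (ler_wpM2l _ (row_le g hij)); last first.
  by rewrite mulr_ge0 // exprn_ge0 // ltW.
rewrite /row mulr_sumr.
rewrite -(big_mkord (fun n => (j <= n)%N) (fun n => c j (n - j)%N)).
rewrite (big_cat_nat (n := j)) //=; last exact: ltnW (ltn_ord j).
rewrite [X in X + _]big1_seq ?add0r; last first.
  by move=> n /andP[hn]; rewrite mem_index_iota; lia.
rewrite -{1}[nat_of_ord j]add0n big_addn.
rewrite (_ : ((N - i).+1 - j = (N - (i + j)).+1)%N); last by have := ltn_ord j; lia.
rewrite big_mkcond /= big_mkord; apply: ler_sum => l _.
by rewrite leq_addl addnK.
Qed.

(** The matrix of the identity function is bidiagonal: the nodes on the diagonal, [rho] next to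
    it. *)
Lemma ddnorm_id r : (forall i, (i <= N)%N -> `|x i| <= r) -> ddnorm id <= r + rho.
Proof.
move=> hr; have r0 : 0 <= r by apply: le_trans (hr 0%N _).
apply: ddnorm_le => [|i hi]; first by rewrite addr_ge0 // ltW.
rewrite /row big_ord_recl expr0 mulr1 lerD //; first by rewrite /= addn0 hr.
apply: (@le_trans _ _ (\sum_(j < (N - i)) (if j == 0%N :> nat then rho else 0))).
  apply: ler_sum => j _; rewrite lift0 dd_id; last by apply: (shiftD hi); have := ltn_ord j; lia.
  rewrite eqSS; case: eqP => [->|_]; last by rewrite normr0 mul0r.
  by rewrite normr1 mul1r expr1.
case: (N - i)%N => [|n]; first by rewrite big_ord0 ltW.
by rewrite big_ord_recl big1 /= ?addr0.
Qed.

(* [f = p / (1 - g)] solves [f = p + g f]. *)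
Lemma ddnorm_div f p g G : (forall i, (i <= N)%N -> f (x i) = p (x i) + g (x i) * f (x i)) ->
  ddnorm g <= G -> G < 1 -> ddnorm f <= ddnorm p / (1 - G).
Proof.
move=> h hg G1; rewrite ler_pdivlMr ?subr_gt0 //.
have : ddnorm f <= ddnorm p + ddnorm g * ddnorm f.
  rewrite {1}(@eq_ddnorm f (fun t => p t + g t * f t) h); apply: le_trans (ddnormD _ _) _.
  by rewrite lerD2l ddnormM.
have : ddnorm g * ddnorm f <= G * ddnorm f by rewrite ler_wpM2r // ddnorm_ge0.
lra.
Qed.

Lemma dd_le_ddnorm f : `|dd f N x| * rho ^+ N <= ddnorm f.
Proof.
apply: le_trans (row_le f (leq0n N)); rewrite /row subn0 big_ord_recr /=.
by rewrite lerDr; apply: sumr_ge0 => j _; rewrite mulr_ge0 // exprn_ge0 // ltW.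
Qed.

End Norm.
End DividedDifferences.

(** * Contraction of the positive cone *)

Section ConeContraction.
Variables (R : realFieldType) (d m : nat) (i0 i1 : 'I_d).
Implicit Types (A B : 'I_m -> 'I_d -> 'I_d -> R) (s : seq 'I_m).

Definition act B s : 'I_d -> R :=
  foldr (fun k v i => \sum_j B k i j * v j) (fun=> 1) s.

Definition slope B s : R := act B s i1 / act B s i0.

Definition slope_gap B s1 s2 : R := slope B s1 - slope B s2.

(* Rank-one matrices whose images have pairwise different slopes [k+1]. *)
Definition pert (k : 'I_m) (i j : 'I_d) : R := if i == i1 then k.+1%:R else 1.

Definition line A (t : R) : 'I_m -> 'I_d -> 'I_d -> R :=
  fun k i j => A k i j + t * pert k i j.

Definition in_range (a b : R) B := forall k i j, a <= B k i j <= b.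

Lemma pert_ge1 k i j : 1 <= pert k i j.
Proof. by rewrite /pert; case: ifP => // _; rewrite ler1n. Qed.

Lemma pert_le k i j : pert k i j <= m%:R.
Proof.
rewrite /pert; case: ifP => _; first by rewrite ler_nat ltn_ord.
by rewrite ler1n; apply: leq_ltn_trans (ltn_ord k).
Qed.

Lemma line_in_range a b A t T : in_range a b A -> 0 <= t <= T ->
  in_range a (b + T * m%:R) (line A t).
Proof.
move=> hA /andP[t0 tT] k i j; have /andP[h1 h2] := hA k i j; rewrite /line.
have p1 := pert_ge1 k i j; have p2 := pert_le k i j.
have h3 : 0 <= t * pert k i j by rewrite mulr_ge0 // (le_trans ler01).
have h4 : t * pert k i j <= T * m%:R.
  by apply: ler_pM => //; rewrite (le_trans ler01).
by apply/andP; split; lra.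
Qed.

Lemma line_line A t u : line (line A t) u = line A (t + u).
Proof.
apply: funext => k; apply: funext => i; apply: funext => j.
by rewrite /line; ring.
Qed.

Lemma act_gt0 a b B s i : 0 < a -> in_range a b B -> 0 < act B s i.
Proof.
move=> a0 hB; elim: s i => [|k s IH] i //=.
apply: (@lt_le_trans _ _ (B k i i * act B s i)).
  by rewrite mulr_gt0 //; have /andP[h _] := hB k i i; apply: lt_le_trans h.
rewrite (bigD1 i) //= lerDl; apply: sumr_ge0 => j _.
have /andP[h _] := hB k i j.
by rewrite mulr_ge0 ?ltW // (lt_le_trans a0).
Qed.

(** After the first letter, both coordinates are combinations of the same positive vector with
    weights in [a, b]. *)
Lemma act_ratio a b B s i j : 0 < a -> a <= b -> in_range a b B ->
  a * act B s i <= b * act B s j.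
Proof.
move=> a0 ab hB; case: s => [|k s] /=; first by rewrite !mulr1.
have pos l := @act_gt0 a b B s l a0 hB.
apply: (@le_trans _ _ (a * b * \sum_l act B s l)).
  rewrite -mulrA ler_wpM2l ?(ltW a0) // mulr_sumr; apply: ler_sum => l _.
  by rewrite ler_wpM2r ?(ltW (pos _)) //; have /andP[] := hB k i l.
rewrite [a * b]mulrC -mulrA ler_wpM2l ?(le_trans (ltW a0)) // mulr_sumr.
apply: ler_sum => l _.
by rewrite ler_wpM2r ?(ltW (pos _)) //; have /andP[] := hB k j l.
Qed.

Section Norm.
Variables (N : nat) (x : nat -> R) (rho : R).
Hypothesis rho0 : 0 < rho.
Hypothesis xD : distinct_upto N x.
Local Notation nm := (ddnorm N x rho).

(** Doeblin's argument: removing the common part [al] from both probability vectors leaves u' and v'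
    of mass tau = 1 - d al, and the sum equals tau^-1 times the sum of u'_j v'_k (g_j - g_k), of
    total weight tau. *)
Lemma ddnorm_contraction (u v : 'I_d -> R) (al D : R) (g : 'I_d -> R -> R) :
  (forall j, al <= u j) -> (forall j, al <= v j) ->
  \sum_j u j = 1 -> \sum_j v j = 1 -> d%:R * al < 1 -> 0 <= D ->
  (forall j k, nm (fun t => g j t - g k t) <= D) ->
  nm (fun t => \sum_j (u j - v j) * g j t) <= (1 - d%:R * al) * D.
Proof.
move=> hu hv su sv dal D0 hg.
pose u' j := u j - al; pose v' j := v j - al; pose tau := 1 - d%:R * al.
have su' : \sum_j u' j = tau.
  by rewrite /u' sumrB su sumr_const card_ord -mulr_natl.
have sv' : \sum_j v' j = tau.
  by rewrite /v' sumrB sv sumr_const card_ord -mulr_natl.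
have tau0 : 0 < tau by rewrite subr_gt0.
rewrite (@eq_ddnorm _ _ _ _ rho0 _ (fun t => \sum_j (tau^-1 * u' j) *
    \sum_k v' k * (g j t - g k t))); last first.
  move=> i _.
  have -> : \sum_j (u j - v j) * g j (x i) =
     \sum_j u' j * g j (x i) - \sum_j v' j * g j (x i).
    by rewrite -sumrB; apply: eq_bigr => j _; rewrite /u' /v'; ring.
  under [RHS]eq_bigr => j _.
    rewrite (_ : \sum_k _ = tau * g j (x i) - \sum_k v' k * g k (x i)); last first.
      rewrite -sv' mulr_suml -sumrB; apply: eq_bigr => k _; ring.
    rewrite (_ : _ * _ = u' j * g j (x i) - (tau^-1 * \sum_k v' k * g k (x i)) * u' j); last first.
      rewrite mulrBr -!mulrA [u' j * (tau * _)]mulrCA mulKf ?gt_eqF //; ring.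
    over.
  rewrite sumrB -mulr_sumr su' mulrAC mulVf ?gt_eqF // mul1r //.
apply: le_trans (ddnorm_sum _ _ rho0 _ _) _.
apply: (@le_trans _ _ (\sum_j (tau^-1 * u' j) * (tau * D))); last first.
  by rewrite -mulr_suml -mulr_sumr su' mulVf ?gt_eqF // mul1r.
apply: ler_sum => j _.
have uj : 0 <= tau^-1 * u' j by rewrite mulr_ge0 ?invr_ge0 ?subr_ge0 // ltW.
apply: le_trans (ddnormZ _ _ rho0 _ _) _; rewrite // ger0_norm // ler_wpM2l //.
apply: le_trans (ddnorm_sum _ _ rho0 _ _) _ => //.
rewrite -sv' mulr_suml; apply: ler_sum => k _.
have vk : 0 <= v' k by rewrite subr_ge0.
by apply: le_trans (ddnormZ _ _ rho0 _ _) _; rewrite // ger0_norm // ler_wpM2l.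
Qed.

Variables (a b : R).
Hypotheses (a0 : 0 < a) (ab : a < b).
(** A quarter of the contraction gain a^2/b^2 of one letter; the rest of the gain pays for the
    perturbation and for the renormalisation. *)
Let D0 : R := a ^+ 2 / (4 * b ^+ 2).
Variable A : 'I_m -> 'I_d -> 'I_d -> R.
Hypothesis hA : in_range a b A.
Hypothesis x0 : forall i, (i <= N)%N -> 0 <= x i.
Hypothesis idS : 2 * (m%:R / a) * nm id <= D0 ^+ 2.

Let b0 : 0 < b := lt_trans a0 ab.

(** All these coordinates equal 1 at t = 0, so their oscillation over i measures only the effect of
    moving along the line. *)
Let rel_act s i t := act (line A t) s i / act A s i.

Let D0_gt0 : 0 < D0.
Proof. by rewrite divr_gt0 ?exprn_gt0 // mulr_gt0 // exprn_gt0. Qed.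

Let D1_ge0 : 0 <= 1 + D0.
Proof. by rewrite addr_ge0 // ltW. Qed.

Let D0_lt : D0 < 1 / 4.
Proof.
rewrite /D0 ltr_pdivrMr ?mulr_gt0 ?exprn_gt0 //.
rewrite mulrA divfK ?mul1r; last by rewrite pnatr_eq0.
by rewrite ltrXn2r ?ltW ?nnegrE ?ltW.
Qed.

Let line_gt0 s i l : (l <= N)%N -> 0 < act (line A (x l)) s i.
Proof.
move=> hl; apply: (@act_gt0 a (b + x l * m%:R)) => //.
by apply: line_in_range => //; rewrite x0 /=.
Qed.

(** Induction on the word. A new letter averages the relative coordinates with weights at least
    a^2/(d b^2), which shrinks their oscillation by the factor 1 - 4 D0. The terms in t add at most
    2 e, where e <= D0^2, and renormalising by coordinate [i0] costs a factor 1/(1 - D0 - e). The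
    outcome is again at most D0, whatever the length of the word. *)
Lemma ddnorm_rel_act s i j :
  nm (fun t => (rel_act s i t - rel_act s j t) / rel_act s i0 t) <= D0.
Proof.
elim: s i j => [|k s IH] i j.
  rewrite (@eq_ddnorm _ _ _ _ rho0 _ (fun=> 0)) => [|l _]; last by rewrite subrr mul0r.
  by apply: le_trans (ddnorm_cst _ _ rho0 _) _; rewrite // normr0 ltW.
pose X := act A s; pose X' i := \sum_j A k i j * X j.
have X0 l : 0 < X l by apply: (act_gt0 _ _ a0 hA).
have X'0 l : 0 < X' l by apply: (@act_gt0 a b A (k :: s) l a0 hA).
pose g j t := rel_act s j t / rel_act s i0 t.
have gE j' l : (l <= N)%N -> g j' (x l) = 1 + (rel_act s j' (x l) - rel_act s i0 (x l)) / rel_act s i0 (x l).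
  move=> hl; rewrite /g mulrBl divff; first by ring.
  by rewrite gt_eqF // divr_gt0 ?line_gt0 //; apply: X0.
have gN j' : nm (g j') <= 1 + D0.
  rewrite (@eq_ddnorm _ _ _ _ rho0 _ (fun t => 1 + (rel_act s j' t - rel_act s i0 t) / rel_act s i0 t)); last first.
    by move=> l hl; rewrite gE.
  apply: le_trans (ddnormD _ _ rho0 _ _) _ => //; rewrite lerD //.
  by apply: le_trans (ddnorm_cst _ _ rho0 _) _; rewrite // normr1.
have gD j' k' : nm (fun t => g j' t - g k' t) <= D0.
  rewrite (@eq_ddnorm _ _ _ _ rho0 _ (fun t => (rel_act s j' t - rel_act s k' t) / rel_act s i0 t)); last first.
    by move=> l hl; rewrite /g mulrBl.
  exact: IH.
(* [M] is a stochastic matrix, and [P] carries the part of the letter proportional to t; the row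
   sums of [P] are at most m/a. *)
pose M i j := A k i j * X j / X' i.
pose P i j := pert k i j * X j / X' i.
pose h i t := \sum_j M i j * g j t + \sum_j P i j * (t * g j t).
have hE i' l : (l <= N)%N -> rel_act (k :: s) i' (x l) = h i' (x l) * rel_act s i0 (x l).
  move=> hl; rewrite /h -big_split /= mulr_suml /rel_act /= mulr_suml.
  apply: eq_bigr => j' _; rewrite /g /M /P /line -/X -/(X' i') /rel_act -/X.
  have w0 := line_gt0 s i0 hl.
  have n1 : X i0 != 0 by rewrite gt_eqF.
  have n2 : X j' != 0 by rewrite gt_eqF.
  have n3 : X' i' != 0 by rewrite gt_eqF.
  have n4 : act (line A (x l)) s i0 != 0 by rewrite gt_eqF.
  by move: n4; rewrite /line => n4; field; rewrite n1 n2 n3 n4.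
pose C := m%:R / a.
have C0 : 0 <= C by rewrite divr_ge0 // ltW.
pose e := C * (nm id * (1 + D0)).
have e0 : 0 <= e.
  by rewrite /e mulr_ge0 // mulr_ge0 // (ddnorm_ge0 _ _ rho0).
have eD : e <= D0 ^+ 2.
  apply: le_trans idS; have -> : 2 * (m%:R / a) * nm id = C * (nm id * 2).
    by rewrite /C; ring.
  rewrite /e ler_wpM2l // ler_wpM2l ?(ddnorm_ge0 _ _ rho0) //.
  by have := D0_lt; lra.
have sM i' : \sum_j M i' j = 1.
  by rewrite /M -mulr_suml -/(X' i') divff // gt_eqF.
have P0 i' j' : 0 <= P i' j'.
  by rewrite divr_ge0 ?mulr_ge0 // ?(ltW (X0 _)) ?(ltW (X'0 _)) // (le_trans ler01) // pert_ge1.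
have sP i' : \sum_j P i' j <= C.
  rewrite -[C]mulr1 -(sM i') mulr_sumr; apply: ler_sum => j' _.
  rewrite /P /M !mulrA ler_wpM2r ?invr_ge0 ?(ltW (X'0 _)) //.
  rewrite ler_wpM2r ?(ltW (X0 _)) //.
  have /andP[h1 _] := hA k i' j'.
  apply: le_trans (pert_le k i' j') _.
  rewrite /C mulrAC ler_pdivlMr // ler_wpM2l //.
have tgN j' : nm (fun t => t * g j' t) <= nm id * (1 + D0).
  apply: le_trans (ddnormM rho0 xD _ _) _ => //.
  by rewrite ler_wpM2l ?ddnorm_ge0.
have pN i' l' : nm (fun t => h i' t - h l' t) <= (1 - a ^+ 2 / b ^+ 2) * D0 + 2 * e.
  rewrite (@eq_ddnorm _ _ _ _ rho0 _ (fun t => \sum_j (M i' j - M l' j) * g j t +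
    \sum_j (P i' j - P l' j) * (t * g j t))); last first.
    move=> l hl; rewrite /h -!big_split /= -sumrB; apply: eq_bigr => j' _; ring.
  apply: le_trans (ddnormD _ _ rho0 _ _) _ => //; apply: lerD.
    have al_le i'' j' : a ^+ 2 / (d%:R * b ^+ 2) <= M i'' j'.
      have d0 : 0 < d%:R :> R by rewrite ltr0n; apply: leq_ltn_trans (ltn_ord i0).
      rewrite /M ler_pdivlMr // mulrAC ler_pdivrMr ?mulr_gt0 ?exprn_gt0 //.
      apply: (@le_trans _ _ (a ^+ 2 * (b * \sum_l X l))).
        rewrite ler_wpM2l ?exprn_ge0 ?(ltW a0) // mulr_sumr; apply: ler_sum => l _.
        by rewrite ler_wpM2r ?(ltW (X0 _)) //; have /andP[] := hA k i'' l.
      apply: (@le_trans _ _ (a * b * (d%:R * (b * X j')))).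
        have -> : a ^+ 2 * (b * \sum_l X l) = a * b * (a * \sum_l X l) by ring.
        rewrite ler_wpM2l ?mulr_ge0 ?(ltW a0) ?(ltW b0) //.
        rewrite mulr_sumr mulr_natl -[X in _ *+ X]card_ord -sumr_const.
        by apply: ler_sum => l _; apply: act_ratio => //; rewrite ltW.
      have -> : a * b * (d%:R * (b * X j')) = a * (X j' * (d%:R * b ^+ 2)) by ring.
      rewrite -[leRHS]mulrA ler_wpM2r ?mulr_ge0 ?(ltW (X0 _)) ?(ltW d0) ?exprn_ge0 ?(ltW b0) //.
      by have /andP[] := hA k i'' j'.
    have -> : a ^+ 2 / b ^+ 2 = d%:R * (a ^+ 2 / (d%:R * b ^+ 2)).
      have d0 : d%:R != 0 :> R by rewrite pnatr_eq0 -lt0n; apply: leq_ltn_trans (ltn_ord i0).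
      have b1 : b != 0 by rewrite gt_eqF.
      by field; rewrite d0 b1.
    apply: ddnorm_contraction => //; last exact: ltW.
    have d0 : d%:R != 0 :> R by rewrite pnatr_eq0 -lt0n; apply: leq_ltn_trans (ltn_ord i0).
    have b1 : b != 0 by rewrite gt_eqF.
    have -> : d%:R * (a ^+ 2 / (d%:R * b ^+ 2)) = a ^+ 2 / b ^+ 2 by field; rewrite d0 b1.
    rewrite ltr_pdivrMr ?exprn_gt0 // mul1r.
    by rewrite ltrXn2r ?nnegrE ?ltW.
  apply: le_trans (ddnorm_sum _ _ rho0 _ _) _ => //.
  apply: (@le_trans _ _ (\sum_j (P i' j + P l' j) * (nm id * (1 + D0)))).
    apply: ler_sum => j' _; apply: le_trans (ddnormZ _ _ rho0 _ _) _ => //.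
    apply: ler_pM => //; rewrite ?(ddnorm_ge0 _ _ rho0) //.
    by apply: le_trans (ler_normB _ _) _; rewrite !ger0_norm.
  have -> : 2 * e = (C + C) * (nm id * (1 + D0)) by rewrite /e; ring.
  rewrite -mulr_suml big_split /= ler_wpM2r ?lerD //.
  by rewrite mulr_ge0 ?(ddnorm_ge0 _ _ rho0).
have GN : nm (fun t => 1 - h i0 t) <= D0 + e.
  rewrite (@eq_ddnorm _ _ _ _ rho0 _ (fun t => \sum_j (- M i0 j) * (g j t - g i0 t) +
    \sum_j (- P i0 j) * (t * g j t))); last first.
    move=> l hl.
    have g1 : g i0 (x l) = 1 by rewrite gE // subrr mul0r addr0.
    rewrite -{1}(sM i0) /h opprD addrA -sumrB -sumrN; congr (_ + _).
      by apply: eq_bigr => j' _; rewrite g1; ring.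
    by apply: eq_bigr => j' _; ring.
  apply: le_trans (ddnormD _ _ rho0 _ _) _ => //; apply: lerD.
    apply: le_trans (ddnorm_sum _ _ rho0 _ _) _ => //.
    rewrite -[leRHS]mul1r -(sM i0) mulr_suml; apply: ler_sum => j' _.
    apply: le_trans (ddnormZ _ _ rho0 _ _) _ => //.
    have M0 : 0 <= M i0 j'.
      have /andP[h1 _] := hA k i0 j'.
      by rewrite divr_ge0 ?mulr_ge0 // ?(ltW (X0 _)) ?(ltW (X'0 _)) // (le_trans (ltW a0)).
    by rewrite normrN ger0_norm // ler_wpM2l.
  apply: le_trans (ddnorm_sum _ _ rho0 _ _) _ => //.
  apply: (@le_trans _ _ (\sum_j P i0 j * (nm id * (1 + D0)))).
    apply: ler_sum => j' _; apply: le_trans (ddnormZ _ _ rho0 _ _) _ => //.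
    by rewrite normrN ger0_norm // ler_wpM2l.
  rewrite -mulr_suml /e ler_wpM2r //.
  by rewrite mulr_ge0 ?(ddnorm_ge0 _ _ rho0).
have Gl : D0 + e < 1 by have := D0_lt; move: (D0_gt0) eD; nra.
(* The quotient f = (h i - h j) / h i0 solves f = (h i - h j) + (1 - h i0) f. *)
apply: le_trans (@ddnorm_div _ N x rho rho0 xD _ (fun t => h i t - h j t)
   (fun t => 1 - h i0 t) (D0 + e) _ GN Gl) _.
  move=> l hl; rewrite !hE //.
  have n4 : rel_act s i0 (x l) != 0.
    by rewrite gt_eqF // divr_gt0 ?line_gt0 //; apply: X0.
  have n5 : h i0 (x l) != 0.
    have : 0 < rel_act (k :: s) i0 (x l).
      by rewrite divr_gt0 ?line_gt0 //; apply: (act_gt0 _ _ a0 hA).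
    by rewrite hE // => /gt_eqF; rewrite mulf_eq0 => /norP[].
  by field; rewrite n4 n5.
rewrite ler_pdivrMr ?subr_gt0 //.
apply: le_trans (pN i j) _.
have -> : a ^+ 2 / b ^+ 2 = 4 * D0.
  by rewrite /D0; field; rewrite gt_eqF.
have := D0_lt; have := D0_gt0; nra.
Qed.

Lemma ddnorm_slope s : nm (fun t => slope (line A t) s) <= 2 * b / a.
Proof.
have X0 l : 0 < act A s l by apply: (act_gt0 _ _ a0 hA).
rewrite (@eq_ddnorm _ _ _ _ rho0 _ (fun t => act A s i1 / act A s i0 *
  (1 + (rel_act s i1 t - rel_act s i0 t) / rel_act s i0 t))); last first.
  move=> l hl; rewrite /slope /rel_act.
  have n1 : act A s i0 != 0 by rewrite gt_eqF.
  have n2 : act A s i1 != 0 by rewrite gt_eqF.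
  have n4 : act (line A (x l)) s i0 != 0 by rewrite gt_eqF // line_gt0.
  by field; rewrite n1 n2 n4.
apply: le_trans (ddnormZ _ _ rho0 _ _) _ => //.
have -> : 2 * b / a = b / a * 2 by ring.
apply: ler_pM; rewrite ?(ddnorm_ge0 _ _ rho0) //.
  rewrite ger0_norm ?divr_ge0 ?(ltW (X0 _)) //.
  rewrite ler_pdivrMr // mulrAC ler_pdivlMr // mulrC.
  by apply: act_ratio => //; rewrite ltW.
apply: le_trans (ddnormD _ _ rho0 _ _) _ => //.
have h1 : nm (fun=> 1) <= 1 by apply: le_trans (ddnorm_cst _ _ rho0 _) _; rewrite // normr1.
have h2 := ddnorm_rel_act s i1 i0.
have := D0_lt; lra.
Qed.

Lemma ddnorm_slope_gap s1 s2 : nm (fun t => slope_gap (line A t) s1 s2) <= 4 * b / a.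
Proof.
rewrite (@eq_ddnorm _ _ _ _ rho0 _ (fun t => slope (line A t) s1 + (-1) * slope (line A t) s2)); last first.
  by move=> l _; rewrite /slope_gap; ring.
apply: le_trans (ddnormD _ _ rho0 _ _) _ => //.
have h1 := ddnorm_slope s1.
have h2 : nm (fun t => -1 * slope (line A t) s2) <= 2 * b / a.
  by apply: le_trans (ddnormZ _ _ rho0 _ _) _; rewrite // normrN1 mul1r ddnorm_slope.
have -> : 4 * b / a = 2 * b / a + 2 * b / a by ring.
exact: lerD.
Qed.

End Norm.
End ConeContraction.

(** * Finite order transversality along lines *)

Section Lines.
Variables (R : realType) (d m : nat) (i0 i1 : 'I_d).
Implicit Types (A B : 'I_m -> 'I_d -> 'I_d -> R) (s : seq 'I_m).
Local Notation gap A s1 s2 := (@slope_gap R d m i0 i1 A s1 s2).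
Local Notation line := (@line R d m i1).

Lemma dd_slope_gap (a b : R) : 0 < a -> a < b ->
  exists2 r : R, 0 < r <= 1 & forall A s1 s2 N (x : nat -> R),
    in_range a b A -> distinct_upto N x ->
    (forall i, (i <= N)%N -> 0 <= x i <= r) ->
    `|dd (fun t => gap (line A t) s1 s2) N x| * (2 * r) ^+ N <= 4 * b / a.
Proof.
move=> a0 ab; have b0 := lt_trans a0 ab.
pose D0 : R := a ^+ 2 / (4 * b ^+ 2); pose C : R := m%:R / a.
have D00 : 0 < D0 by rewrite divr_gt0 ?exprn_gt0 // mulr_gt0 // exprn_gt0.
have C0 : 0 <= C by rewrite divr_ge0 // ltW.
pose r1 := D0 ^+ 2 / (6 * C + 6).
have c6 : 0 < 6 * C + 6 by lra.
have r10 : 0 < r1 by rewrite divr_gt0 // exprn_gt0.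
pose r := Num.min 1 r1.
have r0 : 0 < r by rewrite lt_min ltr01.
exists r; first by rewrite r0 ge_min lexx.
move=> A s1 s2 N x hA xD hx.
have rho0 : 0 < 2 * r by lra.
apply: le_trans (dd_le_ddnorm N x rho0 _) _.
apply: ddnorm_slope_gap => //; first by move=> i /hx /andP[].
have hid : ddnorm N x (2 * r) id <= r + 2 * r.
  by apply: ddnorm_id => // i /hx /andP[h1 h2]; rewrite ger0_norm.
apply: (@le_trans _ _ (2 * C * (3 * r1))).
  rewrite -/C ler_wpM2l //; [exact: mulr_ge0|apply: le_trans hid _].
  have : r <= r1 by rewrite ge_min lexx orbT.
  by lra.
have -> : 2 * C * (3 * r1) = 6 * C * D0 ^+ 2 / (6 * C + 6) by rewrite /r1; ring.
rewrite ler_pdivrMr // mulrC -/D0 ler_wpM2l ?exprn_ge0 ?(ltW D00) //; lra.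
Qed.

Lemma pow2_bound (B eta : R) : 0 <= B -> 0 < eta -> exists N, (0 < N)%N /\ B / 2 ^+ N <= eta.
Proof.
move=> B0 e0; pose n := Num.truncn (B / eta); exists n.+1; split => //.
have h : B / eta < n.+1%:R by exact: truncnS_gt.
rewrite ler_pdivrMr ?exprn_gt0 // -ler_pdivrMl // mulrC.
apply: le_trans (ltW h) _; rewrite -natrX ler_nat ltnW // ltn_expl //.
Qed.

(** * From bounds on divided differences to sparse sublevel sets *)

Section Local.
Variables (a b r B0 : R).
Hypotheses (r0 : 0 < r) (B00 : 0 <= B0).
Hypothesis ddB : forall A s1 s2 N (x : nat -> R),
    in_range a b A -> distinct_upto N x ->
    (forall i, (i <= N)%N -> 0 <= x i <= r) ->
    `|dd (fun t => gap (line A t) s1 s2) N x| * (2 * r) ^+ N <= B0.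

Definition sparse_sublevel N (kappa : R) A s1 s2 := forall (lam : R) (x : nat -> R),
  0 < lam <= r ->
  (forall i, (i < N)%N -> 0 <= x i <= r) ->
  (forall i j, (i < j < N)%N -> lam <= x j - x i) ->
  exists2 i, (i < N)%N & kappa * lam ^+ N < `|gap (line A (x i)) s1 s2|.

Lemma sublevel_sparse (eta : R) : 0 < eta -> exists N (kappa : R), [/\ (0 < N)%N, 0 < kappa &
  forall A s1 s2, in_range a b A ->
   (exists2 t : R, 0 <= t <= r & eta <= `|gap (line A t) s1 s2|) ->
   sparse_sublevel N kappa A s1 s2].
Proof.
move=> e0; have rp := r0.
have [N [N0 hN]] := pow2_bound B00 (divr_gt0 e0 (ltr0n R 2)).
have rr0 : 0 < (2 * r) ^+ N by rewrite exprn_gt0 // mulr_gt0.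
pose kappa := eta / (4 * N.+1%:R * (2 * r) ^+ N).
have k0 : 0 < kappa by rewrite divr_gt0 // !mulr_gt0.
exists N, kappa; split => // A s1 s2 hA [t /andP[t0 tr] ht] lam x /andP[l0 lr] hx hsep.
apply: contrapT => hno.
set f := fun t => gap (line A t) s1 s2.
have hf i : (i < N)%N -> `|f (x i)| <= kappa * lam ^+ N.
  by move=> hi; rewrite leNgt; apply/negP => h; apply: hno; exists i.
have kl : kappa * (2 * r) ^+ N = eta / (4 * N.+1%:R).
  have n1 : (2 * r) ^+ N != 0 by rewrite gt_eqF.
  by rewrite /kappa invfM mulrA divfK.
have q1 : lam ^+ N <= (2 * r) ^+ N by rewrite lerXn2r ?nnegrE ?mulr_ge0 ?(ltW l0) ?(ltW r0) //; lra.
have small : kappa * lam ^+ N <= eta / (4 * N.+1%:R) by rewrite -kl ler_wpM2l // ltW.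
have e4 : eta / (4 * N.+1%:R) <= eta / 4.
  rewrite ler_pM2l // lef_pV2 ?posrE ?mulr_gt0 //.
  by rewrite ler_peMr // ler1n.
pose y i := if (i < N)%N then x i else t.
(* The node t is new, because the gap is at least eta there and at most eta/4 at the other nodes. *)
have yD : distinct_upto N y.
  move=> i j /andP[ij jN]; rewrite /y (leq_trans ij jN).
  case: ifP => hj.
    by have := hsep i j; rewrite ij hj => /(_ isT) h; rewrite -subr_eq0 gt_eqF // (lt_le_trans l0).
  apply/eqP => tx; have := hf i (leq_trans ij jN); rewrite -tx => h.
  by have := le_trans (le_trans ht h) (le_trans small e4); lra.
have yr i : 0 <= y i <= r by rewrite /y; case: ifP => [/hx//|_]; rewrite t0.
have yN : y N = t by rewrite /y ltnn.
have /eqP := newton_interpolation f yD; rewrite yN => /eqP ft.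
have prodle j : `|\prod_(i < j) (t - y i)| <= r ^+ j.
  rewrite normr_prod -[X in _ <= _ ^+ X]card_ord -prodr_const.
  apply: ler_prod => i _; rewrite normr_ge0 /=.
  by have /andP[h1 h2] := yr i; rewrite ler_norml; apply/andP; split; lra.
move: ht; apply/negP; rewrite -ltNge -/(f t) ft.
apply: le_lt_trans (ler_norm_sum _ _ _) _; rewrite big_ord_recr /=.
have hlast : `|dd f N y * \prod_(i < N) (t - y i)| <= eta / 2.
  apply: le_trans hN; rewrite normrM.
  have h1 := ddB s1 s2 hA yD (fun i _ => yr i).
  rewrite ler_pdivlMr ?exprn_gt0 //; apply: le_trans h1.
  by rewrite -mulrA ler_wpM2l // exprMn mulrC ler_wpM2l // exprn_ge0.
have hfirst : \sum_(j < N) `|dd f j y * \prod_(i < j) (t - y i)| <= N%:R * (eta / (4 * N.+1%:R)).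
  rewrite mulr_natl -[X in _ <= _ *+ X]card_ord -sumr_const; apply: ler_sum => j _.
  rewrite normrM.
  have h1 : `|dd f j y| <= (2 / lam) ^+ j * (kappa * lam ^+ N).
    apply: dd_small => //; first by rewrite mulr_ge0 ?exprn_ge0 // ltW.
      move=> i k /andP[ik kj]; have kN := leq_ltn_trans kj (ltn_ord j).
      by rewrite /y kN (ltn_trans ik kN); apply: hsep; rewrite ik.
    move=> i ij; have iN := leq_ltn_trans ij (ltn_ord j).
    by rewrite /y iN; apply: hf.
  apply: (@le_trans _ _ ((2 / lam) ^+ j * (kappa * lam ^+ N) * r ^+ j)).
    by apply: ler_pM.
  have -> : (2 / lam) ^+ j * (kappa * lam ^+ N) * r ^+ j =
     kappa * lam ^+ N * (2 * r / lam) ^+ j by rewrite !exprMn; ring.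
  rewrite -kl -mulrA ler_wpM2l ?(ltW k0) //.
  have -> : (2 * r) ^+ N = lam ^+ N * (2 * r / lam) ^+ N.
    by rewrite -exprMn [lam * _]mulrC divfK // gt_eqF.
  rewrite ler_wpM2l ?exprn_ge0 ?(ltW l0) // ler_weXn2l //; last exact: ltnW.
  by rewrite ler_pdivlMr // mul1r; lra.
apply: le_lt_trans (lerD hfirst hlast) _.
have : N%:R * (eta / (4 * N.+1%:R)) <= eta / 4.
  rewrite mulrC mulrAC ler_pdivrMr ?mulr_gt0 //.
  have -> : eta / 4 * (4 * N.+1%:R) = eta * N.+1%:R by field.
  by rewrite ler_wpM2l ?(ltW e0) // ler_nat.
move=> h; apply: le_lt_trans (lerD h (lexx _)) _; lra.
Qed.

(* Propagates a lower bound for the gap backwards along the line, by steps r/2. *)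
Lemma gap_propagation l : exists2 eta : R, 0 < eta & forall A s1 s2,
  (forall t : R, 0 <= t <= l%:R * (r / 2) + r -> in_range a b (line A t)) ->
  1 / 2 <= `|gap (line A (l%:R * (r / 2))) s1 s2| ->
  exists2 t : R, 0 <= t <= r & eta <= `|gap (line A t) s1 s2|.
Proof.
have rp := r0; elim: l => [|l [eta e0 IH]].
  exists (1 / 2) => [|A s1 s2 _ h]; first by lra.
  by exists (0%:R * (r / 2)) => //; rewrite mul0r lexx ltW.
have [N [kappa [N0 k0 hN]]] := sublevel_sparse e0.
(* N nodes with this spacing fit into [0, r/2]. Based at [line A (r / 2)], one of them carries a
   large gap, and seen from A it lies in [r/2, r]. *)
pose lam := r / (2 * N%:R).
have N0' : 0 < N%:R :> R by rewrite ltr0n.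
have lam0 : 0 < lam by rewrite divr_gt0 // mulr_gt0.
have Nlam : N%:R * lam = r / 2 by rewrite /lam; field; rewrite gt_eqF.
exists (kappa * lam ^+ N); first by rewrite mulr_gt0 // exprn_gt0.
move=> A s1 s2 hA hT.
have lr0 : 0 <= l%:R * (r / 2) by rewrite mulr_ge0 // divr_ge0 // ltW.
have eqS : l.+1%:R * (r / 2) = r / 2 + l%:R * (r / 2).
  by rewrite -natr1; ring.
have hA2 : in_range a b (line A (r / 2)).
  by apply: hA; rewrite eqS; apply/andP; split; lra.
have hT2 : exists2 t : R, 0 <= t <= r & eta <= `|gap (line (line A (r / 2)) t) s1 s2|.
  apply: IH; last by rewrite line_line -eqS.
  move=> t /andP[t0 tl]; rewrite line_line; apply: hA; rewrite eqS.
  by apply/andP; split; lra.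
have [|||i iN hi] := hN _ s1 s2 hA2 hT2 lam (fun i => i%:R * lam).
- rewrite lam0 /=; apply: (@le_trans _ _ (N%:R * lam)); last by lra.
  by rewrite ler_peMl ?ler1n // ltW.
- move=> i iN; rewrite mulr_ge0 ?(ltW lam0) //=.
  apply: (@le_trans _ _ (N%:R * lam)); last by lra.
  by rewrite ler_wpM2r ?(ltW lam0) // ler_nat ltnW.
- move=> i j /andP[ij jN]; rewrite -mulrBl ler_peMl ?(ltW lam0) //.
  by rewrite -natrB ?ler1n ?subn_gt0 // ltnW.
exists (r / 2 + i%:R * lam); last by rewrite -line_line ltW.
have h1 : 0 <= i%:R * lam by rewrite mulr_ge0 // ltW.
have h2 : i%:R * lam <= r / 2 by rewrite -Nlam ler_wpM2r ?(ltW lam0) // ler_nat ltnW.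
by apply/andP; split; lra.
Qed.

End Local.

(** At time T the rank-one part dominates the first letter, so the slope is within 1/4 of k + 1
    whatever the other letters are; two different integers then leave a gap of at least 1 - 1/4 -
    1/4. *)
Lemma gap_far (a b T : R) A k1 k2 s1 s2 : i0 != i1 -> 0 < a -> a < b -> in_range a b A ->
  4 * (m%:R + 1) * b <= T -> k1 != k2 ->
  1 / 2 <= `|gap (line A T) (k1 :: s1) (k2 :: s2)|.
Proof.
move=> i01 a0 ab hA hT k12; have b0 := lt_trans a0 ab.
have T0 : 0 < T by apply: lt_le_trans hT; rewrite !mulr_gt0 // ltr_wpDl.
have hs k s : `|slope i0 i1 (line A T) (k :: s) - k.+1%:R| <= 1 / 4.
  pose z := act (line A T) s.
  have z0 j : 0 < z j.
    apply: (@act_gt0 _ _ _ a (b + T * m%:R)) => //.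
    by apply: line_in_range => //; rewrite lexx ltW.
  rewrite /slope /= -/z.
  pose v0 := \sum_j line A T k i0 j * z j.
  have v00 : T * \sum_j z j <= v0.
    rewrite mulr_sumr; apply: ler_sum => j _; rewrite ler_wpM2r ?(ltW (z0 _)) //.
    have /andP[h _] := hA k i0 j.
    by rewrite /line /pert (negbTE i01) mulr1 lerDr (le_trans (ltW a0)).
  have Z0 : 0 < \sum_j z j.
    by rewrite (bigD1 i0) //= ltr_wpDr // sumr_ge0 // => j _; rewrite ltW.
  have v0p : 0 < v0 by apply: lt_le_trans v00; rewrite mulr_gt0.
  have -> : (\sum_j line A T k i1 j * z j) / v0 - k.+1%:R =
     (\sum_j (A k i1 j - k.+1%:R * A k i0 j) * z j) / v0.
    rewrite -[X in _ - X](mulfK (lt0r_neq0 v0p)) -mulrBl; congr (_ / _).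
    rewrite /v0 mulr_sumr -sumrB; apply: eq_bigr => j _.
    by rewrite /line /pert (negbTE i01) eqxx; ring.
  rewrite normrM normfV (gtr0_norm v0p) ler_pdivrMr //.
  apply: le_trans (ler_norm_sum _ _ _) _.
  apply: (@le_trans _ _ ((m%:R + 1) * b * \sum_j z j)).
    rewrite mulr_sumr; apply: ler_sum => j _.
    rewrite normrM (gtr0_norm (z0 _)) ler_wpM2r ?(ltW (z0 _)) //.
    have /andP[h1 h2] := hA k i0 j; have /andP[h3 h4] := hA k i1 j.
    apply: le_trans (ler_normB _ _) _.
    have h5 := le_trans (ltW a0) h1; have h6 := le_trans (ltW a0) h3.
    rewrite normrM (ger0_norm h5) (ger0_norm h6) ger0_norm //.
    rewrite mulrDl mul1r addrC lerD //.
    by apply: ler_pM => //; rewrite ler_nat.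
  have h : 4 * ((m%:R + 1) * b * \sum_j z j) <= v0.
    by apply: le_trans v00; rewrite !mulrA ler_wpM2r // ltW.
  move: h; move: (_ * \sum_j z j) => w; lra.
have hk : 1 <= `|k1.+1%:R - k2.+1%:R : R|.
  wlog : k1 k2 k12 {s1 s2} / (k1 < k2)%N => [W|h].
    case: (ltngtP k1 k2) => h; first exact: W.
      by rewrite distrC; apply: W => //; rewrite eq_sym.
    by move/val_inj: h k12 => ->; rewrite eqxx.
  by rewrite distrC ger0_norm ?subr_ge0 ?ler_nat 1?ltnW // -natrB ?ler1n ?subn_gt0 // ltnW.
have := hs k1 s1; have := hs k2 s2; rewrite /slope_gap.
move: hk; set u := slope _ _ _ (k1 :: _); set v := slope _ _ _ (k2 :: _).
set p := k1.+1%:R; set q := k2.+1%:R => h1 h2 h3.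
have : `|p - q| <= `|u - p| + `|v - q| + `|u - v|.
  have -> : p - q = - (u - p) + (v - q) + (u - v) by ring.
  apply: le_trans (ler_normD _ _) _; rewrite lerD2r.
  by apply: le_trans (ler_normD _ _) _; rewrite normrN.
lra.
Qed.

Lemma sublevel_sparse_uniform (a b : R) : i0 != i1 -> 0 < a -> a < b ->
  exists r N (kappa : R), [/\ 0 < r, (0 < N)%N, 0 < kappa &
  forall A k1 k2 s1 s2, in_range a b A -> k1 != k2 ->
   sparse_sublevel r N kappa A (k1 :: s1) (k2 :: s2)].
Proof.
move=> i01 a0 ab; have b0 := lt_trans a0 ab.
pose T := 4 * (m%:R + 1) * b.
have T0 : 0 < T by rewrite !mulr_gt0 // ltr_wpDl.
(* Range of the entries on the whole segment used: it ends at l (r/2) + r, at most T + 2 because r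
   <= 1. *)
pose b' := b + (T + 2) * m%:R.
have bb' : b <= b' by rewrite lerDl mulr_ge0 //; lra.
have ab' := lt_le_trans ab bb'.
have [r /andP[r0 r1] hr] := dd_slope_gap a0 ab'.
have B0 : 0 <= 4 * b' / a by rewrite divr_ge0 ?mulr_ge0 // ltW // (lt_le_trans b0).
pose l := (Num.truncn (T / (r / 2))).+1.
have r2 : 0 < r / 2 by lra.
have l1 : T <= l%:R * (r / 2).
  by rewrite -ler_pdivrMr // ltW //; exact: truncnS_gt.
have l2 : l%:R * (r / 2) <= T + r / 2.
  rewrite /l -natr1 mulrDl mul1r lerD2r -ler_pdivlMr // truncn_le //.
  by rewrite divr_ge0 ?ltW.
have [eta e0 heta] := gap_propagation r0 B0 hr l.
have [N [kappa [N0 k0 hN]]] := sublevel_sparse r0 B0 hr e0.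
exists r, N, kappa; split => // A k1 k2 s1 s2 hA k12.
have rng (t : R) : 0 <= t <= l%:R * (r / 2) + r -> in_range a b' (line A t).
  move=> /andP[t0 tl] k i j.
  have := @line_in_range _ _ _ i1 a b A t (T + 2) hA.
  by apply; apply/andP; split; lra.
apply: hN; first by move=> k i j; have /andP[h1 h2] := hA k i j; rewrite h1 (le_trans h2).
by apply: heta => //; apply: (gap_far (a := a) (b := b)) => //.
Qed.

End Lines.

(** * Counting separated tuples with a small gap *)

Section FiniteCounting.

Definition upd (I : finType) (M : nat) (c0 : I) (f : {ffun I -> 'I_M}) (k : 'I_M)
  : {ffun I -> 'I_M} := [ffun c => if c == c0 then k else f c].

(** Fubini on the grid. The involution [h] exchanges the coordinate [c0] of f with k, so summing
    over all lines counts every point of G exactly M times. *)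
Lemma card_fiberwise (I : finType) (M K : nat) (c0 : I) (G : {set {ffun I -> 'I_M}}) :
  (forall f, #|[set k | upd c0 f k \in G]| <= K)%N -> (M * #|G| <= K * M ^ #|I|)%N.
Proof.
move=> hK.
pose h (p : {ffun I -> 'I_M} * 'I_M) := (upd c0 p.1 p.2, p.1 c0).
have hI : involutive h.
  move=> [f k]; rewrite /h /=; congr (_, _); last by rewrite ffunE eqxx.
  by apply/ffunP => c; rewrite !ffunE; case: eqP => // ->.
have -> : (M * #|G| = \sum_f \sum_k (upd c0 f k \in G))%N.
  rewrite pair_big /= (reindex h) /=; last by exists h => p _; apply: hI.
  under eq_bigr => p _ do rewrite -[upd _ _ _]/((h (h p)).1) hI.
  rewrite -(pair_big xpredT xpredT (fun f (_ : 'I_M) => nat_of_bool (f \in G))) /=.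
  under eq_bigr => f _ do rewrite sum_nat_const card_ord.
  rewrite -big_distrr /= -sum1_card; congr (_ * _)%N; rewrite big_mkcond /=.
  by apply: eq_bigr => f _; case: (_ \in _).
apply: (@leq_trans (\sum_(f : {ffun I -> 'I_M}) K)%N).
  apply: leq_sum => f _; apply: leq_trans (hK f); rewrite -sum1_card [leqRHS]big_mkcond /=.
  by apply: leq_sum => k _; rewrite inE; case: (_ \in _).
by rewrite sum_nat_const card_ffun card_ord mulnC.
Qed.

Lemma nth_sorted_ltn_gap (s : seq nat) i j : sorted ltn s -> (i <= j < size s)%N ->
  (nth 0 s i + (j - i) <= nth 0 s j)%N.
Proof.
move=> hs /andP[ij js]; elim: j ij js => [|j IH] ij js; first by move: ij; case: i => //= _; lia.
move: ij; rewrite leq_eqVlt => /orP[/eqP->|]; first by rewrite subnn addn0.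
rewrite ltnS => ij; have := IH ij (ltnW js).
have : (nth 0 s j < nth 0 s j.+1)%N.
  have := sorted_ltn_nth ltn_trans 0%N hs; apply; rewrite ?inE //; lia.
lia.
Qed.

Lemma separated_subset (M N q : nat) (X : {set 'I_M}) : (N * q < #|X|)%N ->
  exists y : nat -> nat, (forall i, (i < N)%N -> exists2 k : 'I_M, k \in X & y i = k) /\
   (forall i j, (i < j < N)%N -> (y i + q <= y j)%N).
Proof.
move=> hX; pose s := [seq nat_of_ord k | k <- enum X].
have ss : size s = #|X| by rewrite size_map -cardE.
have srt : sorted ltn s.
  rewrite /s /enum_mem -/(enum 'I_M).
  have -> : [seq nat_of_ord k | k <- [seq x <- Finite.enum 'I_M | x \in X]] =
      [seq n <- iota 0 M | if insub n is Some k then k \in X else false].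
    rewrite -val_enum_ord enumT filter_map; congr map; apply: eq_filter => k /=.
    by rewrite valK.
  by apply: sorted_filter; [exact: ltn_trans|exact: iota_ltn_sorted].
(* Every q-th element of X in increasing order. *)
exists (fun i => nth 0 s (i * q))%N; split=> [i iN|i j /andP[ij jN]].
  have hi : (i * q < size s)%N by rewrite ss; apply: leq_ltn_trans hX; rewrite leq_mul2r ltnW ?orbT.
  have : nth 0%N s (i * q) \in s by apply: mem_nth.
  by case/mapP => k; rewrite mem_enum => kX ->; exists k.
have hj : (j * q < size s)%N by rewrite ss; apply: leq_ltn_trans hX; rewrite leq_mul2r ltnW ?orbT.
have hij : (i * q <= j * q)%N by rewrite leq_mul2r ltnW ?orbT.
apply: leq_trans (nth_sorted_ltn_gap srt (i := (i * q)%N) (j := (j * q)%N) _); last by rewrite hij.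
rewrite leq_add2l -mulnBl; apply: leq_pmull; lia.
Qed.

End FiniteCounting.

(** * Lipschitz dependence of the gap on the matrix entries *)

Section Lipschitz.
Variables (R : realType) (d m : nat) (i0 i1 : 'I_d).
Variables (a b : R).
Hypotheses (a0 : 0 < a) (ab : a < b).
Implicit Types (A B : 'I_m -> 'I_d -> 'I_d -> R) (s : seq 'I_m).

Lemma act_lbound n : exists2 c : R, 0 < c & forall B s i, size s = n ->
  in_range a b B -> c <= act B s i.
Proof.
elim: n => [|n [c c0 IH]]; first by exists 1 => // B [|//] i _ _.
exists (a * c); first by rewrite mulr_gt0.
move=> B [//|k s] i [ss] hB /=.
have h j : a * c <= B k i j * act B s j.
  by have /andP[h1 _] := hB k i j; apply: ler_pM; rewrite ?(ltW a0) ?(ltW c0) // IH.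
apply: le_trans (h i) _; rewrite (bigD1 i) //= lerDl; apply: sumr_ge0 => j _.
by apply: le_trans (h j); rewrite mulr_ge0 // ltW.
Qed.

Lemma act_ubound n : exists2 U : R, 0 < U & forall B s i, size s = n ->
  in_range a b B -> act B s i <= U.
Proof.
have b0 := lt_trans a0 ab.
elim: n => [|n [U U0 IH]]; first by exists 1 => // B [|//] i _ _.
exists (d%:R * (b * U)).
  by rewrite !mulr_gt0 // ltr0n; apply: leq_ltn_trans (ltn_ord i0).
move=> B [//|k s] i [ss] hB /=.
rewrite mulr_natl -[X in _ <= _ *+ X]card_ord -sumr_const; apply: ler_sum => j _.
have /andP[h1 h2] := hB k i j; have h3 := le_trans (ltW a0) h1.
by apply: ler_pM => //; [exact: ltW (act_gt0 _ _ a0 hB)|exact: IH].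
Qed.

Definition entrywise_close (e : R) B B' := forall k i j, `|B k i j - B' k i j| <= e.

Lemma act_lip n : exists2 L : R, 0 < L & forall B B' s i e, size s = n ->
  in_range a b B -> in_range a b B' -> entrywise_close e B B' -> 0 <= e ->
  `|act B s i - act B' s i| <= L * e.
Proof.
have b0 := lt_trans a0 ab.
elim: n => [|n [L L0 IH]].
  by exists 1 => // B B' [|//] i e _ _ _ _ e0; rewrite subrr normr0 mul1r.
have [U U0 hU] := act_ubound n.
exists (d%:R * (U + b * L)).
  by rewrite !mulr_gt0 ?addr_gt0 ?mulr_gt0 // ltr0n; apply: leq_ltn_trans (ltn_ord i0).
move=> B B' [//|k s] i e [ss] hB hB' hN e0 /=.
rewrite -sumrB; apply: le_trans (ler_norm_sum _ _ _) _.
rewrite -mulrA mulr_natl -[X in _ <= _ *+ X]card_ord -sumr_const; apply: ler_sum => j _.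
have -> : B k i j * act B s j - B' k i j * act B' s j =
   (B k i j - B' k i j) * act B s j + B' k i j * (act B s j - act B' s j) by ring.
apply: le_trans (ler_normD _ _) _; rewrite !normrM mulrDl [U * e]mulrC -[b * L * e]mulrA.
have /andP[h1 h2] := hB' k i j.
have h3 := le_trans (ltW a0) h1.
have h4 := act_gt0 s j a0 hB.
apply: lerD; apply: ler_pM => //; first by rewrite gtr0_norm // hU.
  by rewrite ger0_norm.
exact: IH.
Qed.

Lemma slope_lip n : exists2 L : R, 0 < L & forall B B' s e, size s = n ->
  in_range a b B -> in_range a b B' -> entrywise_close e B B' -> 0 <= e ->
  `|slope i0 i1 B s - slope i0 i1 B' s| <= L * e.
Proof.
have [c c0 hc] := act_lbound n; have [U U0 hU] := act_ubound n.
have [L L0 hL] := act_lip n.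
exists (2 * U * L / (c * c)); first by rewrite divr_gt0 ?mulr_gt0.
move=> B B' s e ss hB hB' hN e0; rewrite /slope.
have p1 := act_gt0 s i0 a0 hB; have p2 := act_gt0 s i0 a0 hB'.
have p3 := act_gt0 s i1 a0 hB'.
set u1 := act B s i1; set u0 := act B s i0; set v1 := act B' s i1; set v0 := act B' s i0.
have -> : u1 / u0 - v1 / v0 = ((u1 - v1) * v0 - v1 * (u0 - v0)) / (u0 * v0).
  by field; rewrite !gt_eqF.
rewrite normrM normfV (gtr0_norm (mulr_gt0 p1 p2)).
have -> : 2 * U * L / (c * c) * e = 2 * U * L * e / (c * c) by ring.
apply: ler_pM; rewrite ?invr_ge0 ?mulr_ge0 ?(ltW p1) ?(ltW p2) //; last first.
  by rewrite lef_pV2 ?posrE ?mulr_gt0 //; apply: ler_pM; rewrite ?(ltW c0) ?hc.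
apply: le_trans (ler_normB _ _) _; rewrite !normrM.
have -> : 2 * U * L * e = (L * e) * U + U * (L * e) by ring.
apply: lerD; apply: ler_pM => //; rewrite ?hL //; by rewrite gtr0_norm // hU.
Qed.

Lemma gap_lip n : exists2 L : R, 0 < L & forall B B' s1 s2 e, size s1 = n -> size s2 = n ->
  in_range a b B -> in_range a b B' -> entrywise_close e B B' -> 0 <= e ->
  `|slope_gap i0 i1 B s1 s2| <= `|slope_gap i0 i1 B' s1 s2| + L * e.
Proof.
have [L L0 hL] := slope_lip n; exists (2 * L); first by rewrite mulr_gt0.
move=> B B' s1 s2 e z1 z2 hB hB' hN e0; rewrite /slope_gap.
have h1 := hL _ _ _ _ z1 hB hB' hN e0; have h2 := hL _ _ _ _ z2 hB hB' hN e0.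
move: h1 h2; set u := slope _ _ _ _; set u' := slope _ _ _ _.
set v := slope _ _ _ _; set v' := slope _ _ _ _ => h1 h2.
have -> : u - v = (u' - v') + (u - u') - (v - v') by ring.
apply: le_trans (ler_normB _ _) _.
have := ler_normD (u' - v') (u - u'); lra.
Qed.

End Lipschitz.

Lemma positive_in_range (R : realType) (d m : nat) (B : 'I_m -> 'I_d -> 'I_d -> R) :
  (forall k i j, 0 < B k i j) -> exists a b : R, [/\ 0 < a, a < b & in_range a b B].
Proof.
move=> B0; pose idx := ('I_m * ('I_d * 'I_d))%type; pose at_ (c : idx) := B c.1 c.2.1 c.2.2.
pose a := \big[Num.min/1]_(c : idx) at_ c; pose b := \big[Num.max/2]_(c : idx) at_ c.
exists a, b; split.
- rewrite /a; elim/big_ind: _ => // [u v u0 v0|c _]; last exact: B0.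
  by rewrite lt_min u0.
- apply: (@le_lt_trans _ _ 1).
    rewrite /a; elim/big_rec: _ => // c u _ h; by rewrite ge_min h orbT.
  apply: (@lt_le_trans _ _ 2); first by rewrite ltr1n.
  by rewrite /b; elim/big_rec: _ => // c u _ h; rewrite le_max h orbT.
move=> k i j; rewrite /a /b (bigD1 (k, (i, j))) //= ge_min lexx /=.
by rewrite (bigD1 (k, (i, j))) //= le_max lexx.
Qed.

(** * Packing bounds for separated tuples with a small gap *)

Section Packing.
Variables (R : realType) (d m : nat) (i0 i1 : 'I_d) (k0 : 'I_m).
Hypothesis i01 : i0 != i1.
Implicit Types (A B : 'I_m -> 'I_d -> 'I_d -> R) (s : seq 'I_m).
Local Notation gap B s1 s2 := (slope_gap i0 i1 B s1 s2).
Local Notation idx := ('I_m * ('I_d * 'I_d))%type.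
Let c0 : idx := (k0, (i0, i0)).
Let P (c : idx) : R := pert R i1 c.1 c.2.1 c.2.2.
Let at_ B (c : idx) : R := B c.1 c.2.1 c.2.2.

(* Coordinates in which the lines [line A] are parallel to the axis [c0]. *)
Let shear B (c : idx) : R := if c == c0 then at_ B c0 else at_ B c - P c * at_ B c0.

Let Pc0 : P c0 = 1. Proof. by rewrite /P /pert /= (negbTE i01). Qed.

Let P_ge0 c : 0 <= P c. Proof. exact: le_trans ler01 (pert_ge1 _ _ _ _ _). Qed.

Let P_le c : P c <= m%:R. Proof. exact: pert_le. Qed.

Section Cells.
Variables (Bs : 'I_m -> 'I_d -> 'I_d -> R) (h sig : R).
Hypotheses (h0 : 0 < h) (sig0 : 0 < sig).
(** Radius of a cube containing the sheared image of the cube of radius h, since the weights [P] are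
    at most m; [M'.+1] cells of side [sig] cover each of its edges. *)
Let H : R := (m%:R + 1) * h.
Let M' : nat := Num.truncn (2 * H / sig).
Let H0 : 0 < H. Proof. by rewrite mulr_gt0 // ltr_wpDl. Qed.

Let cell B : {ffun idx -> 'I_M'.+1} :=
  [ffun c => inord (Num.truncn ((shear B c - shear Bs c + H) / sig))].

(** The lower corner of a cell, brought back from sheared to matrix coordinates. *)
Let ref (f : {ffun idx -> 'I_M'.+1}) : 'I_m -> 'I_d -> 'I_d -> R := fun k i j =>
  let c := (k, (i, j)) in
  let t := shear Bs c0 - H + sig * (f c0)%:R in
  if c == c0 then t else shear Bs c - H + sig * (f c)%:R + P c * t.

Let shear_range B : entrywise_close h B Bs -> forall c, `|shear B c - shear Bs c| <= H.
Proof.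
move=> hB c; have hc c' : `|at_ B c' - at_ Bs c'| <= h by apply: hB.
rewrite /shear /H; case: eqP => _.
  apply: le_trans (hc _) _; rewrite ler_peMl ?(ltW h0) // lerDr //.
have -> : at_ B c - P c * at_ B c0 - (at_ Bs c - P c * at_ Bs c0) =
   (at_ B c - at_ Bs c) - P c * (at_ B c0 - at_ Bs c0) by ring.
apply: le_trans (ler_normB _ _) _; rewrite mulrDl mul1r addrC lerD // normrM.
by apply: ler_pM; rewrite // ger0_norm.
Qed.

Let cell_close B c : entrywise_close h B Bs ->
  0 <= (shear B c - shear Bs c + H) - sig * (cell B c)%:R <= sig.
Proof.
move=> /shear_range-/(_ c); rewrite ler_norml => /andP[h1 h2].
set y := shear B c - shear Bs c in h1 h2 *.
have y0 : 0 <= (y + H) / sig by rewrite divr_ge0 ?(ltW sig0) //; lra.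
have /andP[t1 t2] := truncn_itv y0.
have tM : (Num.truncn ((y + H) / sig) <= M')%N.
  by apply: le_truncn; rewrite ler_pM2r ?invr_gt0 //; lra.
rewrite ffunE inordK ?ltnS //.
move: t1 t2; rewrite ler_pdivlMr // ltr_pdivrMr //; move: (Num.truncn _) => n.
rewrite -[n.+1%:R]natr1 => t1 t2; apply/andP; split; lra.
Qed.

Let ref_close B : entrywise_close h B Bs -> entrywise_close ((m%:R + 1) * sig) (ref (cell B)) B.
Proof.
move=> hB k i j; rewrite /ref -/(at_ B (k, (i, j))); set c := (k, (i, j)).
have /andP[e1 e2] := cell_close c0 hB.
have sc0 : shear B c0 = at_ B c0 by rewrite /shear eqxx.
have m0 : 0 <= m%:R :> R by [].
have n0 : `|shear Bs c0 - H + sig * (cell B c0)%:R - at_ B c0| <= sig.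
  by rewrite ler_norml; apply/andP; split; lra.
case: eqP => [->|ne].
  by apply: le_trans n0 _; rewrite ler_peMl ?(ltW sig0) // lerDr.
have /andP[e3 e4] := cell_close c hB.
have sc : at_ B c = shear B c + P c * at_ B c0.
  by rewrite /shear; move/eqP: ne => /negbTE ->; ring.
rewrite sc; set t := shear Bs c0 - _ + _ in n0 *.
have -> : shear Bs c - H + sig * (cell B c)%:R + P c * t - (shear B c + P c * at_ B c0) =
  (shear Bs c - H + sig * (cell B c)%:R - shear B c) + P c * (t - at_ B c0) by ring.
apply: le_trans (ler_normD _ _) _; rewrite mulrDl mul1r addrC lerD //.
  by rewrite normrM; apply: ler_pM; rewrite // ger0_norm.
by rewrite ler_norml; apply/andP; split; lra.
Qed.

Let ref_upd f (k k' : 'I_M'.+1) : (k' <= k)%N ->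
  ref (upd c0 f k) = line i1 (ref (upd c0 f k')) (sig * (k - k')%:R).
Proof.
move=> kk; apply: funext => l; apply: funext => i; apply: funext => j.
rewrite /ref /line; set c := (l, (i, j)); rewrite -/(P c) natrB //.
rewrite !ffunE eqxx; case: eqP => [->|_]; first by rewrite Pc0; ring.
ring.
Qed.

(** The separation puts the tuples into different cells, and the corner of each such cell still has
    gap at most kappa lam^N with lam = q sig. On a line of cells parallel to axis [c0],
    transversality allows at most N q such corners; [card_fiberwise] then bounds the number of
    cells. *)
Lemma packing_count (a b r kappa L : R) (N q : nat) (k1 k2 : 'I_m) s1 s2 (J : finType)
    (B : J -> 'I_m -> 'I_d -> 'I_d -> R) :
  (forall k i j, a <= Bs k i j - (m%:R + 2) * h) ->
  (forall k i j, Bs k i j + (m%:R + 2) * h <= b) ->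
  (forall A, in_range a b A -> sparse_sublevel i0 i1 r N kappa A (k1 :: s1) (k2 :: s2)) ->
  (forall A B' e, in_range a b A -> in_range a b B' -> entrywise_close e A B' -> 0 <= e ->
     `|gap A (k1 :: s1) (k2 :: s2)| <= `|gap B' (k1 :: s1) (k2 :: s2)| + L * e) ->
  (0 < N)%N -> 0 < kappa ->
  2 * H <= r -> sig <= h -> 0 < q%:R * sig <= r ->
  L * ((m%:R + 1) * sig) <= kappa / 2 * (q%:R * sig) ^+ N ->
  (forall j, entrywise_close h (B j) Bs) ->
  (forall j, `|gap (B j) (k1 :: s1) (k2 :: s2)| <= kappa / 2 * (q%:R * sig) ^+ N) ->
  (forall j j', j != j' -> ~ entrywise_close (2 * (m%:R + 1) * sig) (B j) (B j')) ->
  #|J|%:R * sig ^+ #|{: idx}| <= N%:R * (3 * H) ^+ #|{: idx}| / (2 * H) * (q%:R * sig).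
Proof.
move=> ha hb hsp hlip N0 kap0 Hr sh /andP[lam0 lamr] hL hB hgap hsep.
have hp := h0; have sp := sig0; have Hp := H0.
pose G := [set cell (B j) | j in J].
have cinj : injective (fun j => cell (B j)).
  move=> j j' /= e; apply/eqP; apply/negPn/negP => /hsep; apply => k i l.
  have h1 := ref_close (hB j) k i l; have h2 := ref_close (hB j') k i l.
  rewrite e in h1; move: h1 h2; set u := ref _ _ _ _; move: (B j k i l) (B j' k i l) => v w h1 h2.
  have -> : v - w = (u - w) - (u - v) by ring.
  by apply: le_trans (ler_normB _ _) _; lra.
have cG : #|G| = #|J| by rewrite card_imset.
have rng j : in_range a b (B j) /\ in_range a b (ref (cell (B j))).
  have m0 : 0 <= m%:R :> R by [].
  have mh : 0 <= m%:R * h by rewrite mulr_ge0 // ltW.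
  have ms : (m%:R + 1) * sig <= (m%:R + 1) * h by rewrite ler_wpM2l // addr_ge0.
  split=> k i l; have := hB j k i l; have := ref_close (hB j) k i l.
    rewrite !ler_norml => _ /andP[h1 h2]; have := ha k i l; have := hb k i l => h3 h4.
    by apply/andP; split; lra.
  rewrite !ler_norml => /andP[h5 h6] /andP[h1 h2]; have := ha k i l; have := hb k i l => h3 h4.
  by apply/andP; split; lra.
(* More than N q cells would contain N cells that are q apart, hence N corners on one line at mutual
   distance at least q sig; the first of them serves as origin of the line. *)
have fib f : (#|[set k | upd c0 f k \in G]| <= N * q)%N.
  rewrite leqNgt; apply/negP => /separated_subset[y [yG ysep]].
  have [kk] := yG 0%N N0; rewrite inE => /imsetP[j0 _ ej0] y0.
  pose A := ref (upd c0 f kk).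
  have hA : in_range a b A by rewrite /A ej0; have [] := rng j0.
  have ymono i : (i < N)%N -> (y 0 <= y i)%N.
    by case: i => // i iN; apply: leq_trans (ysep 0%N i.+1 _); rewrite ?leq_addr //.
  have [|||i iN] := hsp A hA (q%:R * sig) (fun i => sig * (y i - y 0)%:R).
  - by rewrite lam0.
  - move=> i iN; rewrite mulr_ge0 ?(ltW sig0) //=; apply: le_trans Hr.
    have [ki _ yi] := yG i iN.
    rewrite mulrC -ler_pdivlMr //; apply: (@le_trans _ _ M'%:R).
      by rewrite ler_nat yi; apply: leq_trans (leq_subr _ _) _; rewrite -ltnS.
    by rewrite truncn_le divr_ge0 // ltW // mulr_gt0.
  - move=> i l /andP[il lN]; rewrite -mulrBr mulrC ler_wpM2l ?(ltW sig0) //.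
    have := ysep i l; rewrite il lN => /(_ isT) h1; have h2 := ymono i (ltn_trans il lN).
    rewrite -natrB; last by lia.
    rewrite ler_nat; move: (y l) (y 0%N) (y i) h1 h2 => u v w h1 h2. clear -h1 h2; lia.
  have [ki] := yG i iN; rewrite inE => /imsetP[j _ ej] yi.
  have := ymono i iN; rewrite y0 yi => kki.
  rewrite /A -ref_upd // ej => hlt.
  have [r1 r2] := rng j.
  have := hlip _ _ _ r2 r1 (ref_close (hB j)).
  have ms : 0 <= (m%:R + 1) * sig by rewrite mulr_ge0 ?addr_ge0 // ltW.
  move=> /(_ ms); have := hgap j; move: hlt hL.
  move: (_ ^+ N) => w; lra.
have := card_fiberwise fib; rewrite cG => cnt.
have {}cnt : M'.+1%:R * #|J|%:R <= N%:R * q%:R * M'.+1%:R ^+ #|{: idx}| :> R.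
  by rewrite -natrX -!natrM ler_nat.
have Mlo : 2 * H <= M'.+1%:R * sig.
  by rewrite -ler_pdivrMr // ltW //; exact: truncnS_gt.
have Mhi : M'.+1%:R * sig <= 3 * H.
  have : M'%:R * sig <= 2 * H.
    by rewrite -ler_pdivlMr // truncn_le divr_ge0 // ltW // mulr_gt0.
  have : h <= H by rewrite /H ler_peMl ?(ltW h0) // lerDr.
  by rewrite -natr1 mulrDl mul1r; lra.
have H2 : 0 < 2 * H by lra.
rewrite mulrAC ler_pdivlMr //.
apply: (@le_trans _ _ (#|J|%:R * sig ^+ #|{: idx}| * (M'.+1%:R * sig))).
  by rewrite ler_wpM2l ?mulr_ge0 ?exprn_ge0 // ltW.
have -> : #|J|%:R * sig ^+ #|{: idx}| * (M'.+1%:R * sig) =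
  (M'.+1%:R * #|J|%:R) * (sig * sig ^+ #|{: idx}|) by ring.
apply: (@le_trans _ _ (N%:R * q%:R * M'.+1%:R ^+ #|{: idx}| * (sig * sig ^+ #|{: idx}|))).
  by rewrite ler_wpM2r ?mulr_ge0 ?exprn_ge0 // ltW.
have -> : N%:R * q%:R * M'.+1%:R ^+ #|{: idx}| * (sig * sig ^+ #|{: idx}|) =
   N%:R * (M'.+1%:R * sig) ^+ #|{: idx}| * (q%:R * sig) by rewrite exprMn; ring.
rewrite ler_wpM2r ?(ltW lam0) // ler_wpM2l //; apply: lerXn2r => //; rewrite nnegrE.
  by rewrite mulr_ge0 // ltW.
by rewrite mulr_ge0 // ltW.
Qed.

End Cells.

Lemma gap_packing Bs : (forall k i j, 0 < Bs k i j) ->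
  exists (h kappa C lam0 : R) (N : nat), [/\ 0 < h, 0 < kappa, 0 < C, 0 < lam0 & (0 < N)%N] /\
  forall n, exists2 L : R, 0 < L & forall (q : nat) (sig : R) k1 k2 s1 s2 (J : finType)
     (B : J -> 'I_m -> 'I_d -> 'I_d -> R),
   (0 < q)%N -> 0 < sig <= h -> q%:R * sig <= lam0 -> L * sig <= kappa * (q%:R * sig) ^+ N ->
   k1 != k2 -> size s1 = n -> size s2 = n ->
   (forall j, entrywise_close h (B j) Bs) ->
   (forall j, `|gap (B j) (k1 :: s1) (k2 :: s2)| <= kappa * (q%:R * sig) ^+ N) ->
   (forall j j', j != j' -> ~ entrywise_close (2 * (m%:R + 1) * sig) (B j) (B j')) ->
   #|J|%:R * sig ^+ #|{: idx}| <= C * (q%:R * sig).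
Proof.
move=> Bs0.
have [lo [hi [lo0 lohi loP]]] := positive_in_range Bs0.
pose a := lo / 2; pose b := hi + lo.
have a0 : 0 < a by rewrite divr_gt0.
have ab : a < b by rewrite /a /b; move: lohi lo0; lra.
have [r [N [kappa [r0 N0 kap0 hsp]]]] := @sublevel_sparse_uniform R d m i0 i1 a b i01 a0 ab.
have m1 : 0 < m%:R + 1 :> R by rewrite ltr_wpDl.
have m2 : 0 < m%:R + 2 :> R by rewrite ltr_wpDl.
(* The first bound keeps tuples and cell corners inside [a, b]; the second makes the lines of cells
   no longer than r. *)
pose h := Num.min (lo / (2 * (m%:R + 2))) (r / (2 * (m%:R + 1))).
have h0 : 0 < h by rewrite lt_min !divr_gt0 // mulr_gt0.
have hlo : (m%:R + 2) * h <= lo / 2.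
  rewrite mulrC -ler_pdivlMr // ge_min; apply/orP; left.
  by rewrite -mulrA -invfM.
have hr : 2 * ((m%:R + 1) * h) <= r.
  rewrite mulrA mulrC -ler_pdivlMr ?mulr_gt0 // ge_min lexx orbT //.
pose H := (m%:R + 1) * h.
have H0 : 0 < H by rewrite mulr_gt0.
exists h, (kappa / 2), (N%:R * (3 * H) ^+ #|{: idx}| / (2 * H)), r, N; split.
  split => //; first by rewrite divr_gt0.
  by rewrite divr_gt0 ?mulr_gt0 ?exprn_gt0 ?ltr0n // mulr_gt0.
move=> n; have [L L0 hL] := @gap_lip R d m i0 i1 a b a0 ab n.+1.
exists (L * (m%:R + 1)); first by rewrite mulr_gt0.
move=> q sig k1 k2 s1 s2 J B q0 /andP[sig0 sh] lamr Lsig k12 z1 z2 hB hgap hsep.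
apply: (@packing_count Bs h sig h0 sig0 a b r kappa L N q k1 k2 s1 s2 J B) => //.
- by move=> k i j; have /andP[] := loP k i j; move: hlo; rewrite /a; lra.
- by move=> k i j; have /andP[] := loP k i j; move: hlo lo0; rewrite /b; lra.
- by move=> A hA; apply: hsp.
- by move=> A B' e h1 h2 h3 h4; apply: hL => //=; rewrite ?z1 ?z2.
- by rewrite mulr_gt0 // ltr0n.
- by rewrite mulrA.
Qed.

End Packing.

Local Open Scope classical_set_scope.

(** * Null sets *)

Section NullSets.
Variable R : realType.

(** The first N pairs lie in a square of side K, and injectivity of f prevents a term from being
    counted twice. *)
Lemma sum_reindex_le (v : nat -> nat -> R) (c : nat -> R) (x : R) (f : nat -> nat * nat) :
  injective f -> (forall n i, 0 <= v n i) ->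
  (forall n N, \sum_(i < N) v n i <= c n) -> (forall N, \sum_(n < N) c n <= x) ->
  forall N, \sum_(k < N) v (f k).1 (f k).2 <= x.
Proof.
move=> finj v0 hc hx N.
pose K := (\max_(k < N) maxn (f k).1 (f k).2).+1.
have fK (k : 'I_N) : ((f k).1 < K)%N /\ ((f k).2 < K)%N.
  have := @leq_bigmax _ (fun k : 'I_N => maxn (f k).1 (f k).2) k.
  by rewrite geq_max => /andP[]; rewrite /K !ltnS.
apply: le_trans (hx K).
apply: (@le_trans _ _ (\sum_(n < K) \sum_(i < K) v n i)); last by apply: ler_sum => n _; apply: hc.
have -> : \sum_(k < N) v (f k).1 (f k).2 =
   \sum_(k < N) \sum_(n < K) \sum_(i < K) (if f k == (n : nat, i : nat) then v n i else 0).
  apply: eq_bigr => k _; have [k1 k2] := fK k.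
  rewrite (bigD1 (Ordinal k1)) //= (bigD1 (Ordinal k2)) //= -surjective_pairing eqxx.
  rewrite big1 => [|i ik]; last first.
    by case: eqP => // e; move/eqP: ik; case; apply: val_inj; rewrite /= e.
  rewrite big1 => [|n nk]; first by rewrite !addr0.
  rewrite big1 // => i _; case: eqP => // e; move/eqP: nk; case; apply: val_inj.
  by rewrite /= e.
rewrite exchange_big; apply: ler_sum => n _; rewrite exchange_big; apply: ler_sum => i _.
case: (pickP (fun k : 'I_N => f k == (n : nat, i : nat))) => [k fk|none]; last first.
  by rewrite big1 // => k _; rewrite none.
rewrite (bigD1 k) //= fk big1 ?addr0 // => k' k'k; case: eqP => // e.
by move/eqP: k'k; case; apply/val_inj/finj; rewrite e; apply/esym/eqP.
Qed.

Lemma nat_pair_surj : exists f : nat -> nat * nat, injective f /\ forall p, exists k, f k = p.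
Proof.
have /card_esym/card_set_bijP[f [_ fi fs]] := card_nat2.
exists f; split => [a b e|p]; first by apply: fi; rewrite ?inE.
by have [k _ <-] := fs p I; exists k.
Qed.

Lemma geometric_sum_le (e : R) N : 0 <= e -> \sum_(n < N) e / 2 ^+ n.+1 <= e.
Proof.
move=> e0; have -> : \sum_(n < N) e / 2 ^+ n.+1 = e - e / 2 ^+ N.
  elim: N => [|N IH]; first by rewrite big_ord0 expr0 divr1 subrr.
  rewrite big_ord_recr /= IH exprS invfM; field.
  by rewrite expf_neq0.
by rewrite gerBl divr_ge0 // exprn_ge0.
Qed.

Section Matrices.
Variables p q : nat.
Implicit Types E : set 'M[R]_(p, q).

Definition cover_le E (x : R) := exists a b : nat -> 'M[R]_(p, q),
    (forall k i j, a k i j <= b k i j) /\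
    E `<=` \bigcup_k box (a k) (b k) /\
    (forall N, \sum_(k < N) box_vol (a k) (b k) <= x).

Definition fin_cover_le E (x : R) := exists s : seq ('M[R]_(p, q) * 'M[R]_(p, q)),
  [/\ forall ab, ab \in s -> forall i j, ab.1 i j <= ab.2 i j,
      forall u, E u -> exists2 ab, ab \in s & box ab.1 ab.2 u &
      \sum_(ab <- s) box_vol ab.1 ab.2 <= x].

Definition cube (u : 'M[R]_(p, q)) (r : R) : set 'M[R]_(p, q) :=
  [set v | forall i j, `|v i j - u i j| < r].

Lemma box_vol_ge0 (a b : 'M[R]_(p, q)) : (forall i j, a i j <= b i j) -> 0 <= box_vol a b.
Proof. by move=> h; apply: prodr_ge0 => i _; apply: prodr_ge0 => j _; rewrite subr_ge0. Qed.

Lemma leb_null_sub E F : E `<=` F -> leb_null F -> leb_null E.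
Proof.
move=> EF hF e e0; have [a [b [h1 [h2 h3]]]] := hF e e0.
by exists a, b; split => //; split => //; apply: subset_trans h2.
Qed.

Lemma cover_le_bigcup (E : nat -> set 'M[R]_(p, q)) (c : nat -> R) x :
  (forall n, cover_le (E n) (c n)) -> (forall N, \sum_(n < N) c n <= x) ->
  cover_le (\bigcup_n E n) x.
Proof.
move=> hE hx.
have /choice[a /choice[b hab]] := hE.
have [f [fi fs]] := nat_pair_surj.
exists (fun k => a (f k).1 (f k).2), (fun k => b (f k).1 (f k).2); split.
  by move=> k i j; have [h _] := hab (f k).1.
split.
  move=> u [n _ Eu]; have [_ [h _]] := hab n; have [l _ hl] := h u Eu.
  by have [k fk] := fs (n, l); exists k => //; rewrite fk.
apply: (@sum_reindex_le (fun n i => box_vol (a n i) (b n i)) c) => // n.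
  by move=> i; apply: box_vol_ge0; have [h _] := hab n.
by have [_ [_ h]] := hab n.
Qed.

Lemma leb_null_bigcup (E : nat -> set 'M[R]_(p, q)) :
  (forall n, leb_null (E n)) -> leb_null (\bigcup_n E n).
Proof.
move=> hE e e0; apply: (@cover_le_bigcup E (fun n => e / 2 ^+ n.+1)).
  by move=> n; apply: hE; rewrite divr_gt0 // exprn_gt0.
by move=> N; apply: geometric_sum_le; apply: ltW.
Qed.

Lemma fin_cover_le_bigcup (I : finType) (E : I -> set 'M[R]_(p, q)) x :
  (forall i, fin_cover_le (E i) x) -> fin_cover_le (\bigcup_i E i) (#|I|%:R * x).
Proof.
move=> /choice[s hs]; exists (flatten [seq s i | i <- enum I]); split.
- by move=> ab /flattenP[_ /mapP[i _ ->]]; have [h _ _] := hs i; apply: h.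
- move=> u [i _ Eu]; have [_ h _] := hs i; have [ab hab bu] := h u Eu.
  exists ab => //; apply/flattenP; exists (s i) => //.
  by apply: map_f; rewrite mem_enum.
rewrite big_flatten big_map big_enum /= mulr_natl -sumr_const.
by apply: ler_sum => i _; have [_ _] := hs i.
Qed.

(* A maximal separated family in E is the set of centres of a cover of E. *)
Lemma packing_fin_cover E (dl x : R) : 0 < dl ->
  (forall n (u : nat -> 'M[R]_(p, q)), (forall i, (i < n)%N -> E (u i)) ->
     (forall i j, (i < j < n)%N -> exists a b, dl <= `|u j a b - u i a b|) ->
     n%:R * (2 * dl) ^+ (p * q) <= x) -> fin_cover_le E x.
Proof.
move=> dl0 hpack; pose V := (2 * dl) ^+ (p * q).
have V0 : 0 < V by rewrite exprn_gt0 // mulr_gt0.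
have vol (c : 'M[R]_(p, q)) : box_vol (\matrix_(i, j) (c i j - dl)) (\matrix_(i, j) (c i j + dl)) = V.
  rewrite /box_vol.
  under eq_bigr => i _.
    under eq_bigr => j _.
      rewrite !mxE (_ : _ - _ = 2 * dl); last by ring.
      over.
    rewrite prodr_const card_ord; over.
  by rewrite prodr_const card_ord -exprM mulnC.
have alt n : fin_cover_le E x \/ exists u : nat -> 'M[R]_(p, q),
    (forall i, (i < n)%N -> E (u i)) /\
    (forall i j, (i < j < n)%N -> exists a b, dl <= `|u j a b - u i a b|).
  elim: n => [|n [IH|[u [uE us]]]]; first by right; exists (fun=> 0); split => // i j; lia.
    by left.
  case: (pselect (exists2 v, E v & forall i, (i < n)%N -> exists a b, dl <= `|v a b - u i a b|)).
    move=> [v Ev hv]; right; exists (fun i => if (i < n)%N then u i else v); split.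
      by move=> i; case: ifP => // h _; apply: uE.
    move=> i j /andP[ij jn]; have iN : (i < n)%N by lia.
    rewrite iN; case: ifP => hj; first by apply: us; rewrite ij.
    exact: hv.
  move=> hno; left.
  exists [seq (\matrix_(i, j) (u k i j - dl), \matrix_(i, j) (u k i j + dl)) | k <- iota 0 n].
  split.
  - move=> _ /mapP[k _ ->] i j; rewrite !mxE; lra.
  - move=> v Ev; apply: contrapT => hc; apply: hno; exists v => // i iN.
    apply: contrapT => hs; apply: hc.
    exists (\matrix_(a, b) (u i a b - dl), \matrix_(a, b) (u i a b + dl)).
      by apply/mapP; exists i => //; rewrite mem_iota add0n.
    move=> a b; rewrite !mxE.
    have : `|v a b - u i a b| < dl by rewrite ltNge; apply/negP => h; apply: hs; exists a, b.
    by rewrite ltr_norml => /andP[h1 h2]; apply/andP; split; lra.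
  rewrite big_map (eq_bigr (fun=> V)) => [|k _]; last by rewrite /= vol.
  rewrite big_const_seq count_predT size_iota iter_addr_0 -mulr_natl.
  exact: hpack uE us.
have [//|[u [uE us]]] := alt (Num.truncn (x / V)).+1.
have := hpack _ u uE us; rewrite leNgt => /negP[].
by rewrite -ltr_pdivrMr //; exact: truncnS_gt.
Qed.

Hypothesis pq0 : (0 < p * q)%N.

(** Degenerate boxes pad a finite cover to an infinite sequence. In dimension 0 the empty product
    would give them volume 1. *)
Lemma box_vol0 (a : 'M[R]_(p, q)) : box_vol a a = 0.
Proof.
have [p0 q0] : (0 < p)%N /\ (0 < q)%N by move: pq0; rewrite muln_gt0 => /andP[].
rewrite /box_vol (bigD1 (Ordinal p0)) //= (bigD1 (Ordinal q0)) //=.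
by rewrite subrr !mul0r.
Qed.

Lemma fin_cover_cover E x : fin_cover_le E x -> cover_le E x.
Proof.
move=> [s [h1 h2 h3]].
exists (fun k => (nth (0, 0) s k).1), (fun k => (nth (0, 0) s k).2).
have val k i j : (nth (0, 0) s k).1 i j <= (nth (0, 0) s k).2 i j.
  have [ks|ks] := ltnP k (size s); first by apply: h1; apply: mem_nth.
  by rewrite nth_default.
split => //; split.
  move=> u /h2[ab /(nthP (0, 0))[k ks <-] bu]; by exists k.
move=> N; apply: le_trans h3; rewrite (big_nth (0, 0)) big_mkord.
pose v k := box_vol (nth (0, 0) s k).1 (nth (0, 0) s k).2.
have v0 k : 0 <= v k by apply: box_vol_ge0.
rewrite -(big_mkord xpredT v) -[leRHS](big_mkord xpredT v).
have [Ns|Ns] := leqP N (size s).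
  rewrite [leRHS](big_cat_nat (n := N)) //= lerDl; exact: sumr_ge0.
rewrite (big_cat_nat (n := size s)) //= ?(ltnW Ns) //.
rewrite [X in _ + X]big1_seq ?addr0 // => k; rewrite mem_index_iota => /andP[_ /andP[sk _]].
by rewrite /v nth_default //= box_vol0.
Qed.

Lemma leb_null_set0 : leb_null (set0 : set 'M[R]_(p, q)).
Proof.
move=> e e0; apply: fin_cover_cover; exists [::]; split => //.
by rewrite big_nil ltW.
Qed.

Lemma leb_null_fin_cover E :
  (forall e : R, 0 < e -> exists F : nat -> set 'M[R]_(p, q), E `<=` \bigcup_n F n /\
     forall n, fin_cover_le (F n) (e / 2 ^+ n.+1)) -> leb_null E.
Proof.
move=> h e e0; have [F [EF hF]] := h e e0.
have [a [b [h1 [h2 h3]]]] : cover_le (\bigcup_n F n) e.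
  apply: (@cover_le_bigcup _ (fun n => e / 2 ^+ n.+1)) => [n|N].
    exact: fin_cover_cover.
  by apply: geometric_sum_le; apply: ltW.
by exists a, b; split => //; split => //; apply: subset_trans h2.
Qed.

(** A Lindelof argument: countably many cubes with rational centre and radius 1/(l+1) meet E in a
    null set, and every point of E lies in one of them as soon as 2/(l+1) <= r. *)
Lemma leb_null_local E :
  (forall u, E u -> exists2 r : R, 0 < r & leb_null (E `&` cube u r)) -> leb_null E.
Proof.
move=> hE.
pose Q : countType := ('M[rat]_(p, q) * nat)%type.
pose piece (c : Q) := E `&` cube (map_mx ratr c.1) (c.2.+1%:R^-1).
pose F n := if unpickle n is Some c then
   if `[< leb_null (piece c) >] then piece c else set0 else set0.
apply: (@leb_null_sub _ (\bigcup_n F n)); last first.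
  apply: leb_null_bigcup => n; rewrite /F; case: unpickle => [c|]; last exact: leb_null_set0.
  by case: asboolP => // _; exact: leb_null_set0.
move=> u Eu; have [r r0 hr] := hE u Eu.
pose l := Num.truncn (2 / r).
have l0 : 0 < l.+1%:R^-1 :> R by rewrite invr_gt0.
have lr : 2 * l.+1%:R^-1 <= r.
  rewrite ler_pdivrMr // -ler_pdivrMl // mulrC ltW //; exact: truncnS_gt.
have /choice[c hc] : forall ij : 'I_p * 'I_q, exists x : rat, `|u ij.1 ij.2 - ratr x| < l.+1%:R^-1.
  move=> ij; set y := u _ _.
  have yy : y - l.+1%:R^-1 < y + l.+1%:R^-1 by move: (_^-1) l0 => z z0; lra.
  have [x] := rat_in_itvoo yy.
  rewrite in_itv /= => h12; exists x; rewrite ltr_norml.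
  by move: (_^-1) h12 => z /andP[h1 h2]; apply/andP; split; lra.
pose cc : Q := (\matrix_(i, j) c (i, j), l).
have inp : piece cc u.
  split => // i j; rewrite !mxE; exact: (hc (i, j)).
exists (pickle cc) => //; rewrite /F pickleK.
case: asboolP => // -[]; apply: leb_null_sub hr => v [Ev hv]; split => // i j.
have := hv i j; have := hc (i, j); rewrite !mxE /= => h1 h2.
move: (_^-1) lr h1 h2 => z lr h1 h2.
have -> : v i j - u i j = (v i j - ratr (c (i, j))) - (u i j - ratr (c (i, j))) by ring.
by apply: le_lt_trans (ler_normB _ _) _; lra.
Qed.

End Matrices.
End NullSets.

(** * Null sets of tuples with degenerate gaps *)

Section LocalNull.
Variables (R : realType) (d m : nat) (i0 i1 : 'I_d) (k0 : 'I_m).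
Hypothesis i01 : i0 != i1.
Local Notation gap B s1 s2 := (slope_gap i0 i1 B s1 s2).

Definition gap_degenerate (B : 'I_m -> 'I_d -> 'I_d -> R) := forall c : R, 0 < c ->
  exists (k1 k2 : 'I_m) (s1 s2 : seq 'I_m), [/\ k1 != k2, size s1 = size s2 &
    `|gap B (k1 :: s1) (k2 :: s2)| <= c ^+ (size s1).+1].

(* [Psi u l] plays the role of a tuple with parameter u, rescaled by l; since
   the gaps do not depend on l, packing bounds for tuples descend to u. *)
Lemma gap_degenerate_null (Bs : 'I_m -> 'I_d -> 'I_d -> R) : (forall k i j, 0 < Bs k i j) ->
  exists2 h : R, 0 < h &
  forall (p1 p2 q : nat) (W : set 'M[R]_(p1, p2))
    (Psi : 'M[R]_(p1, p2) -> ('I_q -> R) -> 'I_m -> 'I_d -> 'I_d -> R) (h' K : R),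
  0 < h' -> 0 < K -> (p1 * p2 + q = m * (d * d))%N -> (0 < p1 * p2)%N ->
  (forall u l, W u -> (forall i, 0 <= l i <= h') -> entrywise_close h (Psi u l) Bs) ->
  (forall u l u' l' e, W u -> W u' -> (forall i, 0 <= l i <= h') ->
     (forall i, 0 <= l' i <= h') -> 0 <= e -> entrywise_close e (Psi u l) (Psi u' l') ->
     (forall i j, `|u i j - u' i j| <= K * e) /\ (forall i, `|l i - l' i| <= K * e)) ->
  (forall u l s1 s2, W u -> (forall i, 0 <= l i <= h') ->
     gap (Psi u l) s1 s2 = gap (Psi u (fun=> 0)) s1 s2) ->
  leb_null [set u | W u /\ gap_degenerate (Psi u (fun=> 0))].
Proof.
move=> Bs0; have [h [kappa [C [lam0 [N [[h0 kap0 C0 lam00 N0] hpack]]]]]] := gap_packing k0 i01 Bs0.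
exists h => // p1 p2 q W Psi h' K h'0 K0 dimE p0 hnear hlip hinv.
have m0 : (0 < m)%N by apply: leq_ltn_trans (ltn_ord k0).
have m1 : 0 < m%:R + 1 :> R by rewrite ltr_wpDl.
pose D := (m * (d * d))%N.
have cardD : #|{: 'I_m * ('I_d * 'I_d)}| = D by rewrite !card_prod !card_ord.
pose C2 := 2 ^+ (p1 * p2) * (3 * K * (m%:R + 1)) ^+ D * C / h' ^+ q.
have C20 : 0 < C2 by rewrite !(divr_gt0, mulr_gt0, exprn_gt0).
have word_cover (lam : R) n (k1 k2 : 'I_m) s1 s2 : 0 < lam <= lam0 -> k1 != k2 ->
    size s1 = n -> size s2 = n ->
    fin_cover_le [set u | W u /\ `|gap (Psi u (fun=> 0)) (k1 :: s1) (k2 :: s2)| <= kappa * lam ^+ N]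
      (C2 * lam).
  move=> /andP[l0 ll] k12 z1 z2; have [L L0 hL] := hpack n.
  (* The mesh lam/Q must be at most h and fine enough to absorb [L], which depends on n; the final
     bound retains only lam. *)
  pose Q := (Num.truncn (lam / h + L * lam / (kappa * lam ^+ N))).+1.
  have Q0 : 0 < Q%:R :> R by rewrite ltr0n.
  have kl0 : 0 < kappa * lam ^+ N by rewrite mulr_gt0 // exprn_gt0.
  have hQ : lam / h + L * lam / (kappa * lam ^+ N) <= Q%:R by rewrite ltW //; exact: truncnS_gt.
  have q1 : 0 <= lam / h by rewrite ltW // divr_gt0.
  have q2 : 0 <= L * lam / (kappa * lam ^+ N) by rewrite ltW // divr_gt0 // mulr_gt0.
  pose sig := lam / Q%:R.
  have sig0 : 0 < sig by rewrite divr_gt0.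
  have Qsig : Q%:R * sig = lam by rewrite /sig mulrC divfK // gt_eqF.
  have sh : sig <= h.
    rewrite /sig ler_pdivrMr // [h * _]mulrC -ler_pdivrMr //; apply: le_trans hQ; by rewrite lerDl.
  have Lsig : L * sig <= kappa * lam ^+ N.
    rewrite /sig mulrA ler_pdivrMr // [_ * Q%:R]mulrC -ler_pdivrMr //.
    by apply: le_trans hQ; rewrite lerDr.
  (* Larger than K times the separation 2 (m+1) sig, so parameters that are [dl] apart have images
     separated as [hpack] requires. *)
  pose dl := 3 * K * (m%:R + 1) * sig.
  have dl0 : 0 < dl by rewrite /dl; do 3 (apply: mulr_gt0 => //).
  apply: (@packing_fin_cover _ _ _ _ dl) => // n' u uE us.
  pose g := (Num.truncn (h' / dl)).+1.
  have hg : h' <= g%:R * dl by rewrite -ler_pdivrMr // ltW //; exact: truncnS_gt.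
  have hg' (k : 'I_g) : k%:R * dl <= h'.
    rewrite -ler_pdivlMr //; apply: (@le_trans _ _ (Num.truncn (h' / dl))%:R).
      by rewrite ler_nat -ltnS.
    by rewrite truncn_le divr_ge0 // ltW.
  (* Each parameter is combined with all scalings of a grid of step [dl] in [0, h']. This gives n'
     g^q separated tuples in full dimension, and (g dl)^q >= h'^q cancels the added dimensions. *)
  pose lf (f : {ffun 'I_q -> 'I_g}) (i : 'I_q) : R := (f i)%:R * dl.
  have lfP f i : 0 <= lf f i <= h' by rewrite mulr_ge0 ?(ltW dl0) //= hg'.
  pose B (j : 'I_n' * {ffun 'I_q -> 'I_g}) := Psi (u j.1) (lf j.2).
  have uW (i : 'I_n') : W (u i) by have [] := uE i (ltn_ord i).
  have ddl : K * (2 * (m%:R + 1) * sig) < dl.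
    have -> : dl = K * (2 * (m%:R + 1) * sig) + K * ((m%:R + 1) * sig) by rewrite /dl; ring.
    by rewrite ltrDl; do 2 (apply: mulr_gt0 => //).
  have := hL Q sig k1 k2 s1 s2 _ B _ _ _ _ k12 z1 z2 _ _ _; rewrite Qsig => cnt.
  have {}cnt : #|{: 'I_n' * {ffun 'I_q -> 'I_g}}|%:R * sig ^+ D <= C * lam.
    rewrite -cardD; apply: cnt => //; first by rewrite sig0.
    - by move=> j; apply: hnear.
    - by move=> [i f] /=; rewrite /B /= hinv //; have [] := uE i (ltn_ord i).
    move=> [i f] [i' f'] ne hn.
    have [|h1 h2] := hlip _ _ _ _ _ (uW i) (uW i') (lfP f) (lfP f') _ hn.
      by apply: mulr_ge0; [apply: mulr_ge0 => //; exact: ltW m1|exact: ltW].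
    have ff : f = f'.
      apply/ffunP => c; apply/val_inj/eqP; apply/negPn/negP => fc.
      have := le_lt_trans (h2 c) ddl; rewrite ltNge => /negP; apply.
      rewrite /lf -mulrBl normrM (gtr0_norm dl0) ler_peMl ?(ltW dl0) //.
      wlog lt : f f' {ne hn h2} fc / (f c < f' c)%N => [Wl|].
        by case: (ltngtP (f c) (f' c)) => lt; [apply: Wl|rewrite distrC; apply: Wl => //; rewrite eq_sym|by move/eqP: fc => /(_ lt)].
      by rewrite distrC ger0_norm ?subr_ge0 ?ler_nat 1?ltnW // -natrB ?ler1n ?subn_gt0 // ltnW.
    have sep (a b : 'I_n') : (a < b)%N -> (forall x y, `|u b x y - u a x y| <= K * (2 * (m%:R + 1) * sig)) -> False.
      move=> ab hs; have [|x [y hxy]] := us a b; first by rewrite ab ltn_ord.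
      by have := le_lt_trans (le_trans hxy (hs x y)) ddl; rewrite ltxx.
    case: (ltngtP i i') => ii.
    - by apply: (sep _ _ ii) => x y; rewrite distrC.
    - exact: (sep _ _ ii).
    by move/eqP: ne; apply; rewrite ff; congr (_, _); apply: val_inj.
  rewrite card_prod card_ffun !card_ord natrM natrX in cnt.
  rewrite /C2 mulrAC ler_pdivlMr ?exprn_gt0 //.
  apply: (@le_trans _ _ (n'%:R * (2 * dl) ^+ (p1 * p2) * (g%:R * dl) ^+ q)).
    apply: ler_wpM2l.
      by apply: mulr_ge0 => //; apply: exprn_ge0; apply: mulr_ge0 => //; exact: ltW.
    apply: lerXn2r => //; rewrite nnegrE ?(ltW h'0) //.
    by apply: mulr_ge0 => //; exact: ltW.
  have -> : n'%:R * (2 * dl) ^+ (p1 * p2) * (g%:R * dl) ^+ q =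
     2 ^+ (p1 * p2) * (3 * K * (m%:R + 1)) ^+ D * (n'%:R * g%:R ^+ q * sig ^+ D).
    rewrite -[RHS]mulrA.
    have -> : (3 * K * (m%:R + 1)) ^+ D * (n'%:R * g%:R ^+ q * sig ^+ D) = n'%:R * g%:R ^+ q * dl ^+ D.
      by rewrite /dl [in RHS]exprMn; ring.
    by rewrite /D -dimE exprD !exprMn; ring.
  rewrite -[leRHS]mulrA; apply: ler_wpM2l => //; apply: mulr_ge0; first exact: exprn_ge0.
  by apply/exprn_ge0/mulr_ge0; [apply: mulr_ge0 => //; exact: ltW|exact: ltW].
apply: leb_null_fin_cover => // e e0.
pose e1 := Num.min 1 (e / (C2 * lam0)).
have e10 : 0 < e1 by rewrite lt_min ltr01 divr_gt0 // mulr_gt0.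
have e11 : e1 <= 1 by rewrite ge_min lexx.
have e12 : C2 * lam0 * e1 <= e.
  rewrite [_ * e1]mulrC -ler_pdivlMr; last exact: mulr_gt0 C20 lam00.
  by rewrite /e1 ge_min lexx orbT.
have mm0 : 0 < (m * m)%:R :> R by rewrite ltr0n muln_gt0 m0.
(* The m^(2(n+1)) pairs of words times th^(n+1) leave (e1/2)^(n+1), which is summable with total at
   most e1. *)
pose th := e1 / 2 / (m * m)%:R.
have th0 : 0 < th by rewrite !divr_gt0.
have th1 : th <= 1.
  rewrite ler_pdivrMr // mul1r; apply: (@le_trans _ _ 1); first by lra.
  by rewrite ler1n muln_gt0 m0.
pose lam n := lam0 * th ^+ n.+1.
have lamP n : 0 < lam n <= lam0.
  rewrite mulr_gt0 ?exprn_gt0 //= ler_piMr ?(ltW lam00) //.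
  by rewrite exprn_ile1 // ltW.
pose F n := [set u | W u /\ exists k1 k2 s1 s2, [/\ k1 != k2, size s1 = n, size s2 = n &
   `|gap (Psi u (fun=> 0)) (k1 :: s1) (k2 :: s2)| <= kappa * lam n ^+ N]].
exists F; split.
  move=> u [Wu deg].
  (* Degeneracy is used with base t th^N: since t^(n+1) <= t, its power n + 1 is at most kappa
     lam_n^N. *)
  pose t := Num.min 1 (kappa * lam0 ^+ N).
  have t0 : 0 < t by rewrite lt_min ltr01 mulr_gt0 // exprn_gt0.
  have t1 : t <= 1 by rewrite ge_min lexx.
  have t2 : t <= kappa * lam0 ^+ N by rewrite ge_min lexx orbT.
  have [|k1 [k2 [s1 [s2 [k12 ss hg]]]]] := deg (t * th ^+ N); first by rewrite mulr_gt0 // exprn_gt0.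
  exists (size s1) => //; split => //; exists k1, k2, s1, s2; split => //.
  apply: le_trans hg _; rewrite /lam [(t * _) ^+ _]exprMn [(lam0 * _) ^+ _]exprMn -!exprM [(N * _)%N]mulnC mulrA.
  rewrite ler_wpM2r ?exprn_ge0 ?(ltW th0) //; apply: le_trans t2.
  by rewrite exprS ler_piMr ?(ltW t0) // exprn_ile1 // ltW.
move=> n.
pose Wd := ('I_m * n.-tuple 'I_m * ('I_m * n.-tuple 'I_m))%type.
pose G (w : Wd) := [set u | w.1.1 != w.2.1 /\
   (W u /\ `|gap (Psi u (fun=> 0)) (w.1.1 :: w.1.2) (w.2.1 :: w.2.2)| <= kappa * lam n ^+ N)].
have Gc w : fin_cover_le (G w) (C2 * lam n).
  case: (eqVneq w.1.1 w.2.1) => [ee|ne].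
    exists [::]; split => //; first by move=> u []; rewrite ee eqxx.
    by rewrite big_nil mulr_ge0 ?(ltW C20) //; have /andP[/ltW] := lamP n.
  have [s [h1 h2 h3]] := word_cover (lam n) n _ _ _ _ (lamP n) ne (size_tuple w.1.2) (size_tuple w.2.2).
  by exists s; split => // u [_ hu]; apply: h2.
have [s [h1 h2 h3]] := fin_cover_le_bigcup Gc.
exists s; split => //.
  move=> u [Wu [k1 [k2 [s1 [s2 [k12 z1 z2 hg]]]]]]; apply: h2.
  by exists ((k1, tcast z1 (in_tuple s1)), (k2, tcast z2 (in_tuple s2))) => //=; split => //; split => //=; rewrite !val_tcast.
apply: le_trans h3 _.
rewrite !card_prod !card_tuple !card_ord -expnS -expnMn natrX /lam.
have -> : (m * m)%:R ^+ n.+1 * (C2 * (lam0 * th ^+ n.+1)) = C2 * lam0 * (e1 ^+ n.+1 / 2 ^+ n.+1).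
  have -> : e1 ^+ n.+1 / 2 ^+ n.+1 = (m * m)%:R ^+ n.+1 * th ^+ n.+1.
    by rewrite -exprMn /th [(m * m)%:R * _]mulrC divfK ?gt_eqF // -exprVn -exprMn.
  ring.
rewrite mulrA ler_wpM2r ?invr_ge0 ?exprn_ge0 //.
apply: le_trans e12; apply: ler_wpM2l; first exact: ltW (mulr_gt0 C20 lam00).
by rewrite exprS ler_piMr ?(ltW e10) // exprn_ile1 // ltW.
Qed.

End LocalNull.

(** * From gaps of slopes to the norm of differences *)

Section Words.
Variables (R : realType) (d : nat).
Implicit Types X Y U W : 'M[R]_d.

Definition has_entry_ge (e : R) X := exists i j, e <= `|X i j|.

Lemma has_entry_geW e e' X : e' <= e -> has_entry_ge e X -> has_entry_ge e' X.
Proof. by move=> h [i [j hij]]; exists i, j; apply: le_trans hij. Qed.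

Lemma has_entry_ge_tr e X : has_entry_ge e X -> has_entry_ge e X^T.
Proof. by move=> [i [j h]]; exists j, i; rewrite mxE. Qed.

(** If all entries of U X were small, so would be those of X = U^-1 (U X). *)
Lemma has_entry_ge_mull U : U \in unitmx -> exists2 c : R, 0 < c &
  forall X e, 0 < e -> has_entry_ge e X -> has_entry_ge (c * e) (U *m X).
Proof.
move=> uU; pose S := \sum_i \sum_j `|invmx U i j|.
have S0 : 0 <= S by apply: sumr_ge0 => i _; apply: sumr_ge0.
have S1 : 0 < 1 + S by lra.
exists (1 + S)^-1; first by rewrite invr_gt0.
move=> X e e0 [i [j hij]]; apply: contrapT => hno.
have hl l : `|(U *m X) l j| <= (1 + S)^-1 * e.
  by rewrite leNgt; apply/negP => /ltW h; apply: hno; exists l, j.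
move: hij; apply/negP; rewrite -ltNge -(mulKmx uU X) mxE.
apply: le_lt_trans (ler_norm_sum _ _ _) _.
apply: (@le_lt_trans _ _ (S * ((1 + S)^-1 * e))).
  apply: (@le_trans _ _ (\sum_l `|invmx U i l| * ((1 + S)^-1 * e))).
    by apply: ler_sum => l _; rewrite normrM ler_wpM2l.
  rewrite -mulr_suml ler_wpM2r //; first by rewrite mulr_ge0 ?invr_ge0 ?ltW.
  rewrite /S [leRHS](bigD1 i) //= lerDl; by apply: sumr_ge0 => k _; apply: sumr_ge0.
rewrite mulrA -[ltRHS]mul1r ltr_pM2r // ltr_pdivrMr //; lra.
Qed.

Lemma has_entry_ge_mulr U : U \in unitmx -> exists2 c : R, 0 < c &
  forall X e, 0 < e -> has_entry_ge e X -> has_entry_ge (c * e) (X *m U).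
Proof.
rewrite -unitmx_tr => /has_entry_ge_mull[c c0 hc]; exists c => // X e e0 /has_entry_ge_tr hX.
by rewrite -[X *m U]trmxK trmx_mul; apply/has_entry_ge_tr/hc.
Qed.

Lemma norm_le_eucl_norm (x : 'cV[R]_d) i : `|x i 0| <= eucl_norm x.
Proof.
rewrite /eucl_norm -sqrtr_sqr ler_wsqrtr // (bigD1 i) //= lerDl.
by apply: sumr_ge0 => j _; apply: sqr_ge0.
Qed.

Lemma entry_le_op_norm X i j : `|X i j| <= op_norm X.
Proof.
pose x : 'cV[R]_d := delta_mx j 0.
have ex : eucl_norm x = 1.
  rewrite /eucl_norm (bigD1 j) //= big1 => [|k kj].
    by rewrite mxE !eqxx expr1n addr0 sqrtr1.
  by rewrite mxE (negbTE kj) expr0n.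
apply: (@le_trans _ _ (eucl_norm (X *m x))).
  by have := norm_le_eucl_norm (X *m x) i; rewrite -colE mxE.
pose M := \sum_i \sum_j `|X i j|.
apply: ub_le_sup; last by exists x.
(* An explicit upper bound is required before any element can be compared with [sup]. *)
exists (Num.sqrt (\sum_(k < d) M ^+ 2)) => _ [y [ey ->]].
apply: ler_wsqrtr; apply: ler_sum => k _.
rewrite -(real_normK (num_real _)) lerXn2r ?nnegrE //.
  by apply: sumr_ge0 => *; apply: sumr_ge0.
rewrite mxE; apply: le_trans (ler_norm_sum _ _ _) _.
apply: (@le_trans _ _ (\sum_l `|X k l|)).
  apply: ler_sum => l _; rewrite normrM ler_piMr // -ey.
  exact: norm_le_eucl_norm.
by rewrite /M [leRHS](bigD1 k) //= lerDl; apply: sumr_ge0 => *; apply: sumr_ge0.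
Qed.

Section Tuples.
Variable m : nat.
Implicit Types A B : 'I_m -> 'M[R]_d.

Definition entries B : 'I_m -> 'I_d -> 'I_d -> R := fun k i j => B k i j.

Definition prodw A (s : seq 'I_m) := foldr (fun k X => A k *m X) 1%:M s.

Lemma word_prodE n A (w : 'I_n -> 'I_m) : word_prod A w = prodw A [seq w i | i <- enum 'I_n].
Proof.
rewrite /word_prod -(big_map w xpredT A) enumT [index_enum _]unlock.
by elim: [seq _ | _ <- _] => [|k s IH]; rewrite ?big_nil // big_cons IH.
Qed.

Lemma prodw_conj V A s : V \in unitmx ->
  prodw A s = V *m prodw (fun k => invmx V *m A k *m V) s *m invmx V.
Proof.
move=> uV; elim: s => [|k s /= ->]; first by rewrite /= mulmx1 mulmxV.
by rewrite !mulmxA mulmxV // mul1mx.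
Qed.

Lemma act_prodw B s i : act (entries B) s i = \sum_j prodw B s i j.
Proof.
elim: s i => [|k s IH] i /=.
  rewrite (bigD1 i) //= mxE eqxx big1 ?addr0 // => j ji.
  by rewrite mxE eq_sym (negbTE ji).
under eq_bigr => j _ do rewrite IH mulr_sumr.
by rewrite exchange_big /=; apply: eq_bigr => j _; rewrite mxE.
Qed.

Lemma act_ge_pow (a b : R) (B : 'I_m -> 'I_d -> 'I_d -> R) s i : 0 < a -> in_range a b B ->
  a ^+ size s <= act B s i.
Proof.
move=> a0 hB; elim: s i => [|k s IH] i //=.
have pos j : 0 <= B k i j by have /andP[h _] := hB k i j; apply: le_trans h; apply: ltW.
rewrite exprS (bigD1 i) //=; apply: (@le_trans _ _ (B k i i * act B s i)).
  have /andP[h _] := hB k i i; apply: ler_pM; rewrite ?exprn_ge0 ?(ltW a0) //.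
rewrite lerDl; apply: sumr_ge0 => j _; rewrite mulr_ge0 // ltW //.
exact: act_gt0 a0 hB.
Qed.

Variables i0 i1 : 'I_d.

(** Row sums of close products are close, and u1/u0 - v1/v0 = ((u1 - v1) - (v1/v0)(u0 - v0))/u0,
    where v1/v0 <= b/a and u0 is at least a^n. *)
Lemma gap_le_entries (a b e : R) B s1 s2 : 0 < a -> a < b -> in_range a b (entries B) ->
  size s1 = size s2 -> 0 < e -> ~ has_entry_ge e (prodw B s1 - prodw B s2) ->
  `|slope_gap i0 i1 (entries B) s1 s2| * a ^+ size s1 <= d%:R * (1 + b / a) * e.
Proof.
move=> a0 ab hB ss e0 hno; have b0 := lt_trans a0 ab.
have hd i : `|act (entries B) s1 i - act (entries B) s2 i| <= d%:R * e.
  rewrite !act_prodw -sumrB; apply: le_trans (ler_norm_sum _ _ _) _.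
  rewrite mulr_natl -[X in _ <= _ *+ X]card_ord -sumr_const; apply: ler_sum => j _.
  rewrite leNgt; apply/negP => /ltW h; apply: hno; exists i, j.
  by rewrite !mxE.
have p0 := act_gt0 s1 i0 a0 hB; have q0 := act_gt0 s2 i0 a0 hB; have q1 := act_gt0 s2 i1 a0 hB.
have lo := act_ge_pow s1 i0 a0 hB.
have rt : act (entries B) s2 i1 <= b / a * act (entries B) s2 i0.
  by rewrite mulrAC ler_pdivlMr // mulrC; apply: act_ratio => //; apply: ltW.
move: lo p0 q0 q1 rt (hd i0) (hd i1); rewrite /slope_gap /slope.
move: (act _ s1 i0) (act _ s1 i1) (act _ s2 i0) (act _ s2 i1) => u0 u1 v0 v1 lo p0 q0 q1 rt h0 h1.
have -> : u1 / u0 - v1 / v0 = ((u1 - v1) - v1 / v0 * (u0 - v0)) / u0.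
  by field; rewrite !gt_eqF.
have r0 : 0 <= v1 / v0 by rewrite divr_ge0 // ltW.
have r1 : v1 / v0 <= b / a by rewrite ler_pdivrMr.
rewrite normrM normfV (gtr0_norm p0).
have hn : `|u1 - v1 - v1 / v0 * (u0 - v0)| <= d%:R * (1 + b / a) * e.
  apply: le_trans (ler_normB _ _) _; rewrite normrM (ger0_norm r0).
  have -> : d%:R * (1 + b / a) * e = d%:R * e + b / a * (d%:R * e) by ring.
  by rewrite lerD //; apply: ler_pM.
apply: le_trans hn; rewrite -[leLHS]mulrA ler_piMr // mulrC ler_pdivrMr // mul1r //.
Qed.

Lemma strongly_diophantine_of_gap A V : V \in unitmx -> (forall k, A k \in unitmx) ->
  (forall k i j, 0 < (invmx V *m A k *m V) i j) ->
  ~ gap_degenerate i0 i1 (entries (fun k => invmx V *m A k *m V)) ->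
  strongly_diophantine A.
Proof.
move=> uV uA; set B := fun k => _ => B0 ndeg.
have [a [b [a0 ab hB]]] := positive_in_range B0.
have b0 := lt_trans a0 ab.
have [c c0 hc] : exists2 c : R, 0 < c & forall (k1 k2 : 'I_m) s1 s2, k1 != k2 -> size s1 = size s2 ->
    c ^+ (size s1).+1 < `|slope_gap i0 i1 (entries B) (k1 :: s1) (k2 :: s2)|.
  apply: contrapT => hno; apply: ndeg => c c0; apply: contrapT => h; apply: hno.
  exists c => // k1 k2 s1 s2 k12 ss; rewrite ltNge; apply/negP => hle; apply: h.
  by exists k1, k2, s1, s2.
have /choice[cA hcA] : forall k, exists c : R, 0 < c /\
    forall X e, 0 < e -> has_entry_ge e X -> has_entry_ge (c * e) (A k *m X).
  by move=> k; have [x x0 hx] := has_entry_ge_mull (uA k); exists x.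
pose c1 := \big[Num.min/1]_k cA k.
have c10 : 0 < c1.
  rewrite /c1; elim/big_ind: _ => // [u v u0 v0|k _]; last by have [] := hcA k.
  by rewrite lt_min u0.
have c1k k : c1 <= cA k by rewrite /c1 (bigD1 k) //= ge_min lexx.
have [x x0 hx] := has_entry_ge_mull uV.
have uV' : invmx V \in unitmx by rewrite unitmx_inv.
have [y y0 hy] := has_entry_ge_mulr uV'.
have d0 : 0 < d%:R :> R by rewrite ltr0n; apply: leq_ltn_trans (ltn_ord i0).
have D0 : 0 < d%:R * (1 + b / a) by rewrite mulr_gt0 // addr_gt0 // divr_gt0.
pose z := y * (x * (d%:R * (1 + b / a))^-1).
have z0 : 0 < z by rewrite /z; apply: mulr_gt0 => //; apply: mulr_gt0; rewrite ?invr_gt0.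
pose t := Num.min 1 z.
have t0 : 0 < t by rewrite lt_min ltr01.
have t1 : t <= 1 by rewrite ge_min lexx.
have tz : t <= z by rewrite ge_min lexx orbT.
(* [c1] pays for each letter of the common prefix. At the first different letters c a gives the
   rate, while t <= 1 absorbs the constant z through t^(n+1) <= t <= z. *)
pose w := Num.min c1 (t * (c * a)).
have ca0 : 0 < c * a by rewrite mulr_gt0.
have w0 : 0 < w by rewrite lt_min c10 mulr_gt0.
have main s1 s2 : size s1 = size s2 -> s1 != s2 ->
    has_entry_ge (w ^+ size s1) (prodw A s1 - prodw A s2).
  elim: s1 s2 => [|k1 s1 IH] [|k2 s2] //= [ss].
  have [->|k12] := eqVneq k1 k2.
    rewrite eqseq_cons eqxx /= => ne; rewrite -mulmxBr.
    have [_ h] := hcA k2; apply: has_entry_geW (h _ _ _ (IH _ ss ne)).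
      by rewrite exprS ler_wpM2r ?exprn_ge0 ?(ltW w0) // ge_min c1k.
    by rewrite exprn_gt0.
  move=> _; pose e := (d%:R * (1 + b / a))^-1 * (c * a) ^+ (size s1).+1.
  have e0 : 0 < e by rewrite /e; apply: mulr_gt0; rewrite ?invr_gt0 ?exprn_gt0.
  have hBe : has_entry_ge e (prodw B (k1 :: s1) - prodw B (k2 :: s2)).
    apply: contrapT => hno.
    have /= h := gap_le_entries a0 ab hB (congr1 S ss : size (k1 :: s1) = size (k2 :: s2)) e0 hno.
    move: h; rewrite /e mulrA mulfV ?gt_eqF // mul1r exprMn ler_pM2r ?exprn_gt0 //.
    by rewrite leNgt hc.
  have := hy _ _ (mulr_gt0 x0 e0) (hx _ _ e0 hBe).
  rewrite mulmxBr mulmxBl -!prodw_conj //; apply: has_entry_geW.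
  rewrite !mulrA -[y * x * _]mulrA -/z.
  apply: (@le_trans _ _ ((t * (c * a)) ^+ (size s1).+1)).
    by apply: lerXn2r; rewrite ?nnegrE ?(ltW w0) ?mulr_ge0 ?(ltW t0) ?(ltW c0) ?(ltW a0) // ge_min lexx orbT.
  rewrite exprMn ler_wpM2r ?exprn_ge0 ?(ltW ca0) //; apply: le_trans tz.
  by rewrite exprS ler_piMr ?(ltW t0) // exprn_ile1 // ltW.
(* Halving makes the inequality strict; different words have positive length. *)
exists (w / 2); split; first by rewrite divr_gt0.
move=> n w1 w2 ne; rewrite !word_prodE.
set s1 := [seq w1 i | i <- _]; set s2 := [seq w2 i | i <- _].
have z1 : size s1 = n by rewrite size_map size_enum_ord.
have z2 : size s2 = n by rewrite size_map size_enum_ord.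
have sne : s1 != s2.
  apply/eqP => es; apply: ne; apply: funext => i.
  by move/eq_in_map: es; apply; rewrite mem_enum.
have [|i [j hij]] := main s1 s2 _ sne; first by rewrite z1.
apply: lt_le_trans (entry_le_op_norm _ i j); apply: lt_le_trans hij; rewrite z1.
have n0 : (0 < n)%N.
  rewrite lt0n; apply/eqP => n0; move: sne.
  by rewrite (size0nil (etrans z1 n0)) (size0nil (etrans z2 n0)) eqxx.
by rewrite ltrXn2r -?lt0n ?nnegrE ?(ltW w0) //; lra.
Qed.

End Tuples.
End Words.

(** * Immersions *)

Section Immersion.
Variable R : realType.

Lemma linear_injective_lbound (p a b : nat) (L : {linear 'rV[R]_p -> 'M[R]_(a, b)}) :
  injective L -> exists2 c : R, 0 < c & forall v (e : R), 0 <= e ->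
    (forall i j, `|L v i j| <= e) -> forall l, `|v 0 l| <= c * e.
Proof.
move=> Linj; pose M := lin1_mx (mxvec \o L).
have vM v : v *m M = mxvec (L v) by rewrite mul_rV_lin1.
have fM : row_free M.
  apply: inj_row_free => v; rewrite vM => /(congr1 vec_mx); rewrite mxvecK linear0 => Lv.
  by apply: Linj; rewrite Lv linear0.
have [N MN] := row_freeP fM.
pose S := \sum_i \sum_j `|N i j|.
have S0 : 0 <= S by apply: sumr_ge0 => i _; apply: sumr_ge0.
exists (1 + S); first by lra.
move=> v e e0 hv l.
have -> : v = mxvec (L v) *m N by rewrite -vM -mulmxA MN mulmx1.
rewrite mxE; apply: le_trans (ler_norm_sum _ _ _) _.
apply: (@le_trans _ _ (S * e)); last by rewrite ler_wpM2r //; lra.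
rewrite /S mulr_suml; apply: ler_sum => i _; rewrite normrM mulrC.
case/mxvec_indexP: i => i j; rewrite mxvecE; apply: ler_pM => //.
by rewrite (bigD1 l) //= lerDl; apply: sumr_ge0.
Qed.

Lemma nbhs_cube (p q : nat) (u : 'M[R]_(p, q)) (A : set 'M[R]_(p, q)) :
  nbhs u A -> exists2 r : R, 0 < r & cube u r `<=` A.
Proof.
move=> /nbhs_ballP[r /= r0 h]; exists r => // v hv; apply: h.
by split => // i j; rewrite /ball /= distrC; apply: hv.
Qed.

Lemma continuous_entries (p1 p2 q1 q2 : nat) (f : 'M[R]_(p1, p2) -> 'M[R]_(q1, q2)) u (e : R) :
  {for u, continuous f} -> 0 < e ->
  exists2 r : R, 0 < r & forall v, cube u r v -> forall i j, `|f v i j - f u i j| < e.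
Proof.
move=> fc e0.
have : nbhs u (f @^-1` ball (f u) e) by apply: fc; apply: nbhsx_ballx.
move=> /nbhs_cube[r r0 hr]; exists r => // v /hr [_ h] i j.
by rewrite distrC; apply: h.
Qed.

(** Stated entry by entry, since the intermediate point depends on the entry. *)
Lemma mean_value_entries (p a b : nat) (phi : 'rV[R]_p -> 'M[R]_(a, b)) (u v : 'rV[R]_p) i j :
  (forall t : R, 0 <= t <= 1 -> differentiable phi (u + t *: v)) ->
  exists2 t : R, 0 <= t <= 1 & phi (u + v) i j - phi u i j = ('d phi (u + t *: v) v) i j.
Proof.
move=> hd.
pose f (t : R) := phi (u + t *: v) i j.
pose df (t : R) := ('d phi (u + t *: v) v) i j.
have drv (t : R) : 0 <= t <= 1 -> is_derive t 1 f (df t).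
  move=> ht; have dphi := hd t ht.
  have der : derivable phi (u + t *: v) v by apply: diff_derivable.
  have derc : derivable (fun x => phi x i j) (u + t *: v) v by move/derivable_mxP : der; apply.
  have E (h : R) : f (h *: 1 + t) = phi (h *: v + (u + t *: v)) i j.
    by rewrite /f scalerDl [h *: 1]mulr1 addrCA.
  have val : 'D_v (fun x => phi x i j) (u + t *: v) = df t.
    by rewrite /df -deriveE // derive_mx // mxE.
  have EF : (fun h : R => h^-1 *: ((f \o shift t) (h *: 1) - f t)) =
     (fun h : R => h^-1 *: (((fun x => phi x i j) \o shift (u + t *: v)) (h *: v) - phi (u + t *: v) i j)).
    by apply: funext => h /=; rewrite E.
  split; first by rewrite /derivable EF.
  by rewrite -val /derive EF.
have [||c hc] := @MVT_segment R f df 0 1 ler01.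
- by move=> t; rewrite in_itv /= => /andP[h1 h2]; apply: drv; rewrite !ltW.
- apply: derivable_within_continuous => t; rewrite in_itv /= => ht.
  by have [] := drv t ht.
rewrite /f scale1r scale0r addr0 subr0 mulr1 => ->.
by exists c => //; rewrite in_itv /= in hc.
Qed.

(** Quantitative local injectivity: near [u0] the increment of [phi] differs from that of the
    injective linear map ['d phi u0] by at most eta times the l^1 distance of the arguments. *)
Lemma immersion_lbound (p a b : nat) (U : set 'rV[R]_p) (phi : 'rV[R]_p -> 'M[R]_(a, b)) u0 :
  open U -> (forall u, U u -> differentiable phi u /\ injective ('d phi u)) ->
  (forall v, {in U, continuous ('D_v phi)}) -> U u0 ->
  exists r K : R, [/\ 0 < r, 0 < K, cube u0 r `<=` U & forall u u' (e : R), 0 <= e ->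
    cube u0 r u -> cube u0 r u' -> (forall i j, `|phi u i j - phi u' i j| <= e) ->
    forall l, `|u 0 l - u' 0 l| <= K * e].
Proof.
move=> Uo hd hc U0; have [d0 inj0] := hd u0 U0.
have [c c0 hL] := linear_injective_lbound inj0.
have [r1 r10 hr1] : exists2 r : R, 0 < r & cube u0 r `<=` U.
  by apply: nbhs_cube; apply: open_nbhs_nbhs.
(* Chosen so that the error term contributes exactly s/2 and can be absorbed into the left side. *)
pose eta := (2 * (p%:R + 1) * c)^-1.
have p1 : 0 < p%:R + 1 :> R by rewrite ltr_wpDl.
have eta0 : 0 < eta by rewrite invr_gt0 !mulr_gt0.
have /choice[r2 hr2] : forall l : 'I_p, exists r : R, 0 < r /\ forall v, cube u0 r v ->
    forall i j, `|'D_(delta_mx 0 l) phi v i j - 'D_(delta_mx 0 l) phi u0 i j| < eta.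
  move=> l; have [||r r0 hr] := @continuous_entries _ _ _ _ ('D_(delta_mx 0 l) phi) u0 eta => //.
    by apply: hc; rewrite inE.
  by exists r.
pose r := \big[Num.min/r1]_l r2 l.
have r0 : 0 < r.
  rewrite /r; elim/big_ind: _ => // [x y x0 y0|l _]; last by have [] := hr2 l.
  by rewrite lt_min x0.
have rr1 : r <= r1.
  by rewrite /r; elim/big_rec: _ => // l x _ h; rewrite ge_min h orbT.
have rr2 l : r <= r2 l by rewrite /r (bigD1 l) //= ge_min lexx.
have rU : cube u0 r `<=` U by move=> v hv; apply: hr1 => i j; apply: lt_le_trans (hv i j) rr1.
exists r, (2 * (p%:R + 1) * c); split => //; first by rewrite !mulr_gt0.
move=> u u' e e0 hu hu' hphi.
pose v := u - u'.
have seg (t : R) : 0 <= t <= 1 -> cube u0 r (u' + t *: v).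
  move=> /andP[t0 t1] i j; rewrite !mxE.
  have -> : u' i j + t * (u i j - u' i j) - u0 i j =
    t * (u i j - u0 i j) + (1 - t) * (u' i j - u0 i j) by ring.
  apply: le_lt_trans (ler_normD _ _) _; rewrite !normrM (ger0_norm t0) (@ger0_norm _ (1 - t)) ?subr_ge0 //.
  have := hu i j; have := hu' i j; move: `|u i j - _| `|u' i j - _| => x y hy hx.
  have xM : x <= Num.max x y by rewrite le_max lexx.
  have yM : y <= Num.max x y by rewrite le_max lexx orbT.
  have Mr : Num.max x y < r by rewrite gt_max hx.
  apply: le_lt_trans Mr; move: (Num.max x y) xM yM => M xM yM.
  have h1 : t * x <= t * M by rewrite ler_wpM2l.
  have h2 : (1 - t) * y <= (1 - t) * M by rewrite ler_wpM2l // subr_ge0.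
  by lra.
pose s := \sum_l `|v 0 l|.
have s0 : 0 <= s by apply: sumr_ge0.
have Lv i j : `|'d phi u0 v i j| <= e + eta * s.
  have [|t ht hmv] := @mean_value_entries p a b phi u' v i j.
    by move=> t ht; have [] := hd _ (rU _ (seg t ht)).
  have dec x : U x -> 'd phi x v i j = \sum_l v 0 l * 'D_(delta_mx 0 l) phi x i j.
    move=> Ux; have [dx _] := hd x Ux.
    rewrite {1}[v]row_sum_delta linear_sum summxE; apply: eq_bigr => l _.
    by rewrite linearZ mxE deriveE.
  have tri (x y : R) : `|y| <= e -> `|x - y| <= eta * s -> `|x| <= e + eta * s.
    move=> hy hxy; have -> : x = y + (x - y) by ring.
    by apply: le_trans (ler_normD _ _) _; rewrite lerD.
  have hmv' : `|'d phi (u' + t *: v) v i j| <= e by rewrite -hmv /v [u' + _]addrC subrK.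
  rewrite (dec u0 U0); move: hmv'; rewrite (dec _ (rU _ (seg t ht))) => hmv'.
  apply: (tri _ _ hmv'); rewrite -sumrB mulrC /s mulr_suml.
  apply: le_trans (ler_norm_sum _ _ _) _.
  apply: ler_sum => l _; rewrite -mulrBr normrM ler_wpM2l // distrC ltW //.
  have [_ hr2l] := hr2 l.
  exact: (hr2l _ (fun k m => lt_le_trans (seg t ht k m) (rr2 l))).
have es : 0 <= e + eta * s by rewrite addr_ge0 // mulr_ge0 // ltW.
have hl l : `|v 0 l| <= c * (e + eta * s) := hL _ _ es Lv l.
have hs : s <= (p%:R + 1) * (c * (e + eta * s)).
  apply: (@le_trans _ _ (p%:R * (c * (e + eta * s)))).
    by rewrite mulr_natl -[X in _ *+ X]card_ord -sumr_const; apply: ler_sum.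
  by rewrite ler_wpM2r ?mulr_ge0 ?(ltW c0) // lerDl.
have hs2 : s <= 2 * (p%:R + 1) * c * e.
  have E : (p%:R + 1) * (c * (eta * s)) = s / 2.
    rewrite /eta; field; rewrite !gt_eqF //.
  move: hs; rewrite !mulrDr E; nra.
move=> l; apply: le_trans hs2; rewrite /s (bigD1 l) //= !mxE lerDl.
exact: sumr_ge0.
Qed.

End Immersion.

(** * The theorem *)

Section MatrixBounds.
Variables (R : realType) (d : nat).

Lemma mulmx_entry_bound (U W : 'M[R]_d) : exists2 S : R, 0 < S & forall (X : 'M[R]_d) (e : R), 0 <= e ->
  (forall i j, `|X i j| <= e) -> forall i j, `|(U *m X *m W) i j| <= S * e.
Proof.
pose SU := \sum_i \sum_j `|U i j|; pose SW := \sum_j \sum_i `|W i j|.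
have SU0 : 0 <= SU by apply: sumr_ge0 => *; apply: sumr_ge0.
have SW0 : 0 <= SW by apply: sumr_ge0 => *; apply: sumr_ge0.
exists (SW * SU + 1); first by rewrite ltr_wpDl // mulr_ge0.
move=> X e e0 hX i j.
have hUX l : `|(U *m X) i l| <= SU * e.
  rewrite mxE; apply: le_trans (ler_norm_sum _ _ _) _.
  apply: (@le_trans _ _ (\sum_k `|U i k| * e)).
    by apply: ler_sum => k _; rewrite normrM ler_wpM2l.
  rewrite -mulr_suml ler_wpM2r // /SU [leRHS](bigD1 i) //= lerDl.
  by apply: sumr_ge0 => *; apply: sumr_ge0.
rewrite mulrDl mul1r; apply: (@le_trans _ _ (SW * SU * e)); last by rewrite lerDl.
rewrite mxE; apply: le_trans (ler_norm_sum _ _ _) _.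
apply: (@le_trans _ _ (\sum_k `|W k j| * (SU * e))).
  by apply: ler_sum => k _; rewrite normrM mulrC ler_wpM2l.
rewrite -mulr_suml -mulrA ler_wpM2r ?mulr_ge0 // /SW [leRHS](bigD1 j) //= lerDl.
by apply: sumr_ge0 => *; apply: sumr_ge0.
Qed.

Lemma prod_lip (M e : R) (I : Type) (s : seq I) (f g : I -> R) : 1 <= M -> 0 <= e ->
  (forall i, `|f i| <= M) -> (forall i, `|g i| <= M) -> (forall i, `|f i - g i| <= e) ->
  `|\prod_(i <- s) f i - \prod_(i <- s) g i| <= (size s)%:R * M ^+ size s * e.
Proof.
move=> M1 e0 hf hg hfg; have M0 : 0 <= M by apply: le_trans M1.
elim: s => [|i s IH]; first by rewrite !big_nil subrr normr0 !mul0r.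
rewrite !big_cons /=; set F := \prod_(j <- s) f j in IH *; set G := \prod_(j <- s) g j in IH *.
have hF : `|F| <= M ^+ size s.
  rewrite /F normr_prod; elim: (s) => [|j s' IH']; first by rewrite big_nil.
  by rewrite big_cons /= exprS; apply: ler_pM => //; apply: prodr_ge0.
have -> : f i * F - g i * G = (f i - g i) * F + g i * (F - G) by ring.
apply: le_trans (ler_normD _ _) _; rewrite !normrM.
have P0 : 0 <= M ^+ size s by apply: exprn_ge0.
have -> : (size s).+1%:R * M ^+ (size s).+1 * e =
    M ^+ (size s).+1 * e + M * ((size s)%:R * M ^+ size s * e).
  by rewrite -natr1 exprS; ring.
apply: lerD; last by apply: ler_pM.
rewrite mulrC; apply: ler_pM => //; apply: le_trans hF _.
by rewrite exprS ler_peMl.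
Qed.

Lemma det_lip (M : R) : 1 <= M -> exists2 C : R, 0 < C & forall (X Y : 'M[R]_d) (e : R), 0 <= e ->
  (forall i j, `|X i j| <= M) -> (forall i j, `|Y i j| <= M) ->
  (forall i j, `|X i j - Y i j| <= e) -> `|\det X - \det Y| <= C * e.
Proof.
move=> M1; have M0 : 0 <= M by apply: le_trans M1.
pose C := \sum_(s : 'S_d) (d%:R * M ^+ d) : R.
have C0 : 0 <= C by apply: sumr_ge0 => s _; rewrite mulr_ge0 // exprn_ge0.
exists (1 + C); first by rewrite ltr_pwDl.
move=> X Y e e0 hX hY hXY; apply: (@le_trans _ _ (C * e)); last first.
  by rewrite ler_wpM2r // lerDr.
rewrite /determinant -sumrB /C mulr_suml; apply: le_trans (ler_norm_sum _ _ _) _.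
apply: ler_sum => s _; rewrite -mulrBr normrM normr_sign mul1r.
have := @prod_lip M e _ (index_enum 'I_d) (fun i => X i (s i)) (fun i => Y i (s i)) M1 e0.
have -> : size (index_enum 'I_d) = d by rewrite [index_enum _]unlock -enumT size_enum_ord.
by apply.
Qed.

(** Lets the scaling factor of a matrix be recovered from its determinant in a Lipschitz way. *)
Lemma norm_subX_ge n (x y : R) : 1 <= x -> 1 <= y -> `|x - y| <= `|x ^+ n.+1 - y ^+ n.+1|.
Proof.
move=> x1 y1; rewrite subrXX normrM ler_peMr //.
apply: le_trans (ler_norm _); rewrite big_ord_recl /= expr0 mulr1.
apply: (@le_trans _ _ (x ^+ n)); first by rewrite exprn_ege1.
rewrite subn0 lerDl; apply: sumr_ge0 => i _.
by rewrite mulr_ge0 ?exprn_ge0 // (le_trans ler01).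
Qed.

End MatrixBounds.

(** * Conjugating the cone to the positive orthant *)

Section Conjugation.
Variables (R : realType) (d m : nat) (V : 'M[R]_d).
Hypothesis uV : V \in unitmx.
Implicit Types M : 'M[R]_(m, d * d).

Definition conj_tup M : 'I_m -> 'M[R]_d := fun k => invmx V *m tup M k *m V.

Definition positive_conj M := forall k, tup M k \in unitmx /\ forall i j, 0 < conj_tup M k i j.

Lemma tupE M k i j : tup M k i j = M k (mxvec_index i j).
Proof. by rewrite /tup !mxE. Qed.

Lemma conj_tup_lip : exists2 K : R, 0 < K & forall M M' (e : R), 0 <= e ->
  (forall i j, `|M i j - M' i j| <= e) -> entrywise_close (K * e) (entries (conj_tup M)) (entries (conj_tup M')).
Proof.
have [K K0 hK] := mulmx_entry_bound (invmx V) V; exists K => // M M' e e0 h k i j.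
rewrite /entries /conj_tup.
have -> : (invmx V *m tup M k *m V) i j - (invmx V *m tup M' k *m V) i j =
   (invmx V *m (tup M k - tup M' k) *m V) i j by rewrite mulmxBr mulmxBl !mxE.
by apply: hK => // a b; rewrite mxE [X in _ + X]mxE !tupE.
Qed.

Lemma conj_tup_colip : exists2 K : R, 0 < K & forall M M' (e : R), 0 <= e ->
  entrywise_close e (entries (conj_tup M)) (entries (conj_tup M')) -> forall i j, `|M i j - M' i j| <= K * e.
Proof.
have [K K0 hK] := mulmx_entry_bound V (invmx V); exists K => // M M' e e0 h k.
case/mxvec_indexP => i j; rewrite -!tupE.
have E N : tup N k = V *m conj_tup N k *m invmx V.
  by rewrite /conj_tup !mulmxA mulmxV // mul1mx mulmxK.
have -> : tup M k i j - tup M' k i j = (V *m (conj_tup M k - conj_tup M' k) *m invmx V) i j.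
  by rewrite mulmxBr mulmxBl -!E [RHS]mxE [X in _ = _ + X]mxE.
by apply: hK => // a b; have := h k a b; rewrite /entries [X in _ -> `|X| <= _]mxE [X in _ -> `|_ + X| <= _]mxE.
Qed.

Lemma det_conj_tup M k : \det (conj_tup M k) = \det (tup M k).
Proof.
rewrite /conj_tup !det_mulmx det_inv mulrAC mulVf ?mul1r //.
by rewrite -unitfE -unitmxE.
Qed.

(** A V e_j is interior to the cone, so A V e_j - t V e_i stays in it for small t > 0; its i-th
    coefficient is nonnegative, hence the entry is at least t. *)
Lemma strictly_preserves_positive (A : 'M[R]_d) : strictly_preserves (cone V) A ->
  forall i j, 0 < (invmx V *m A *m V) i j.
Proof.
move=> hA i j; pose e (l : 'I_d) : 'cV[R]_d := delta_mx l 0.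
have e_ge0 l k : 0 <= e l k 0 by rewrite mxE; case: (_ && _).
have ne : V *m e j <> 0.
  move=> /(congr1 (mulmx (invmx V))); rewrite mulKmx // mulmx0 => /matrixP/(_ j 0).
  by rewrite !mxE !eqxx => /eqP; rewrite oner_eq0.
have /nbhs_cube[r r0 hr] := hA (V *m e j) (ex_intro _ (e j) (conj (e_ge0 j) erefl)) ne.
pose S := \sum_k `|V k i|; have S0 : 0 <= S by apply: sumr_ge0.
pose t := r / (2 * (1 + S)).
have t0 : 0 < t by rewrite divr_gt0 // mulr_gt0 // ltr_pwDl.
have [|x [x0 hx]] := hr (A *m (V *m e j) - t *: (V *m e i)).
  move=> k l; rewrite ord1 -(colE i V); move: (A *m _) => Y.
  have -> : (Y - t *: col i V) k 0 - Y k 0 = - (t * V k i) by rewrite !mxE; ring.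
  rewrite normrN normrM (gtr0_norm t0).
  apply: (@le_lt_trans _ _ (t * (1 + S))).
    rewrite ler_wpM2l ?(ltW t0) // /S (bigD1 k) //= addrCA lerDl addr_ge0 //; exact: sumr_ge0.
  rewrite /t invfM mulrA divfK ?gt_eqF ?ltr_pwDl //; lra.
have E : x = invmx V *m A *m V *m e j - t *: e i.
  by rewrite -[x](mulKmx uV) -hx mulmxBr -scalemxAr mulKmx // !mulmxA.
have := x0 i; rewrite E [X in 0 <= X]mxE -colE [X in 0 <= X + _]mxE.
by rewrite !mxE !eqxx mulr1 subr_ge0; apply: lt_le_trans.
Qed.

End Conjugation.

Section Scaling.
Variables (R : realType) (d m : nat) (i0 i1 : 'I_d).

Lemma slope_gap_scale (c : 'I_m -> R) (B : 'I_m -> 'I_d -> 'I_d -> R) s1 s2 :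
  (forall k, c k != 0) ->
  slope_gap i0 i1 (fun k i j => c k * B k i j) s1 s2 = slope_gap i0 i1 B s1 s2.
Proof.
move=> c0.
have E s i : act (fun k i j => c k * B k i j) s i = (\prod_(k <- s) c k) * act B s i.
  elim: s i => [|k s IH] i /=; first by rewrite big_nil mulr1.
  rewrite big_cons mulr_sumr; apply: eq_bigr => j _; rewrite IH; ring.
rewrite /slope_gap /slope !E -!mulf_div !divff ?mul1r // prodf_seq_neq0; apply/allP => k _; exact: c0.
Qed.

End Scaling.

Section NullTheorems.
Variables (R : realType) (d m : nat) (V : 'M[R]_d).
Hypotheses (d2 : (2 <= d)%N) (m0 : (0 < m)%N) (uV : V \in unitmx).

Let i0 : 'I_d := Ordinal (ltnW d2).
Let i1 : 'I_d := Ordinal d2.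
Let i01 : i0 != i1. Proof. by []. Qed.
Let k0 : 'I_m := Ordinal m0.

Let degenerate (M : 'M[R]_(m, d * d)) : positive_conj V M ->
  ~ strongly_diophantine (tup M) -> gap_degenerate i0 i1 (entries (conj_tup V M)).
Proof.
move=> hM hSD; apply: contrapT => h; apply: hSD.
apply: (strongly_diophantine_of_gap uV _ _ h) => k; first by have [] := hM k.
by have [] := hM k.
Qed.

Lemma not_strongly_diophantine_null :
  leb_null [set M : 'M[R]_(m, d * d) | positive_conj V M /\ ~ strongly_diophantine (tup M)].
Proof.
have d0 : (0 < d)%N by apply: ltnW.
have dim0 : (0 < m * (d * d))%N by rewrite !muln_gt0 m0 d0.
apply: leb_null_local => // M0 [pos0 _].
have Bs0 k i j : 0 < entries (conj_tup V M0) k i j by have [_] := pos0 k; apply.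
have [h h0 hnull] := gap_degenerate_null k0 i01 Bs0.
have [K K0 hK] := conj_tup_lip m V; have [K' K'0 hK'] := conj_tup_colip m uV.
exists (h / K); first by rewrite divr_gt0.
(* The tuple itself is the parameter and already has full dimension, so q = 0. *)
apply: leb_null_sub (hnull m (d * d)%N 0%N (cube M0 (h / K))
   (fun M _ => entries (conj_tup V M)) 1 K' ltr01 K'0 _ dim0 _ _ _).
- by move=> M [[posM nSD] cM]; split => //; apply: degenerate.
- by rewrite addn0.
- move=> M l cM _; have -> : h = K * (h / K) by rewrite mulrC divfK // gt_eqF.
  by apply: hK => [|i j]; [rewrite divr_ge0 // ltW|rewrite ltW].
- move=> M l M' l' e _ _ _ _ e0 hn; split; first exact: hK'.
  by case.
- by [].
Qed.

Lemma not_strongly_diophantine_SL_null :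
  SL_null [set M : 'M[R]_(m, d * d) | positive_conj V M /\ ~ strongly_diophantine (tup M)].
Proof.
move=> U phi Uo hSL hd hc.
have d0 : (0 < d)%N by apply: ltnW.
have dd0 : (0 < (d * d).-1)%N by case: d d2 => [|[|d']].
have dim0 : (0 < 1 * ((d * d).-1 * m))%N by rewrite mul1n muln_gt0 dd0.
apply: leb_null_local => // u0 [Uu0 [pos0 _]].
have Bs0 k i j : 0 < entries (conj_tup V (phi u0)) k i j by have [_] := pos0 k; apply.
have [h h0 hnull] := gap_degenerate_null k0 i01 Bs0.
have [a [b [_ _ hb]]] := positive_in_range Bs0.
have b0 : 0 < b by have /andP[_ h1] := hb k0 i0 i0; apply: lt_le_trans h1.
have [K1 K10 hK1] := conj_tup_lip m V; have [K2 K20 hK2] := conj_tup_colip m uV.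
have [r1 [K3 [r10 K30 r1U hK3]]] := immersion_lbound Uo hd hc Uu0.
have e1 : 0 < h / 2 / K1 by rewrite !divr_gt0.
have fc : {for u0, continuous phi}.
  by apply: differentiable_continuous; have [] := hd u0 Uu0.
have [r2 r20 hr2] := continuous_entries fc e1.
pose r := Num.min r1 r2.
have r0 : 0 < r by rewrite lt_min r10.
pose W := cube u0 r.
have Wr1 u : W u -> cube u0 r1 u by move=> hu i j; apply: lt_le_trans (hu i j) _; rewrite ge_min lexx.
have Wr2 u : W u -> cube u0 r2 u by move=> hu i j; apply: lt_le_trans (hu i j) _; rewrite ge_min lexx orbT.
have WU u : W u -> U u by move/Wr1/r1U.
pose X u := entries (conj_tup V (phi u)).
have Xnear u : W u -> entrywise_close (h / 2) (X u) (X u0).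
  move=> /Wr2 hu; have -> : h / 2 = K1 * (h / 2 / K1) by rewrite [RHS]mulrC divfK // gt_eqF.
  by apply: hK1 => [|i j]; [exact: ltW|rewrite ltW // hr2].
have Xbound u : W u -> forall k i j, `|X u k i j| <= b + h / 2.
  move=> Wu k i j; have := Xnear u Wu k i j; have /andP[h1 h2] := hb k i j.
  have h3 := Bs0 k i j; rewrite -/(X u0) in h2 h3 *.
  rewrite !ler_norml => /andP[h4 h5]; apply/andP; split; lra.
(* Half of the radius h is spent on moving u, the other half on scaling entries of size at most b +
   h/2. *)
pose h' := h / (2 * (b + h / 2)).
have bh : 0 < b + h / 2 by lra.
have h'0 : 0 < h' by rewrite divr_gt0 // mulr_gt0.
have h'b : h' * (b + h / 2) = h / 2 by rewrite /h' invfM mulrA divfK // gt_eqF.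
have h'1 : h' <= 1 by rewrite ler_pdivrMr ?mulr_gt0 // mul1r; lra.
pose Psi u (l : 'I_m -> R) : 'I_m -> 'I_d -> 'I_d -> R := fun k i j => (1 + l k) * X u k i j.
pose Mb := 1 + 2 * (b + h / 2).
have Mb1 : 1 <= Mb by rewrite lerDl mulr_ge0 // ltW.
have [C C0 hC] := det_lip d Mb1.
have Psib u l : W u -> (forall k, 0 <= l k <= h') -> forall k i j, `|Psi u l k i j| <= Mb.
  move=> Wu hl k i j; rewrite /Psi normrM; have /andP[l0 l1] := hl k.
  apply: (@le_trans _ _ (2 * (b + h / 2))); last by rewrite lerDr.
  by apply: ler_pM => //; [rewrite ger0_norm; lra|exact: Xbound].
have detPsi u l k : W u -> \det (\matrix_(i, j) Psi u l k i j) = (1 + l k) ^+ d.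
  move=> Wu; have -> : \matrix_(i, j) Psi u l k i j = (1 + l k) *: conj_tup V (phi u) k.
    by apply/matrixP => i j; rewrite [LHS]mxE [RHS]mxE.
  by rewrite detZ det_conj_tup // (hSL u (WU u Wu)) mulr1.
pose K := C + K3 * (K2 * (1 + C * (b + h / 2))).
have KK : 0 < K3 * (K2 * (1 + C * (b + h / 2))).
  by apply: mulr_gt0 => //; apply: mulr_gt0 => //; rewrite ltr_pwDl // mulr_ge0 // ltW.
have K0 : 0 < K by rewrite addr_gt0.
have dimE : (1 * ((d * d).-1 * m) + m = m * (d * d))%N.
  by rewrite mul1n -mulSnr prednK ?muln_gt0 ?d0 // mulnC.
have hnullW := hnull 1%N ((d * d).-1 * m)%N m W Psi h' K h'0 K0 dimE dim0.
exists r => //; apply: (leb_null_sub _ (hnullW _ _ _)).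
- move=> u [[Uu [posu nSD]] cu].
  split; first by [].
  have -> : Psi u (fun=> 0) = X u.
    by apply: funext => k; apply: funext => i; apply: funext => j; rewrite /Psi addr0 mul1r.
  exact: degenerate.
- move=> u l Wu hl k i j; have /andP[l0 l1] := hl k; rewrite /Psi -/(X u0).
  have -> : (1 + l k) * X u k i j - X u0 k i j = (X u k i j - X u0 k i j) + l k * X u k i j by ring.
  apply: le_trans (ler_normD _ _) _.
  have -> : h = h / 2 + h' * (b + h / 2) by rewrite h'b; field.
  apply: lerD; first exact: Xnear.
  by rewrite normrM; apply: ler_pM => //; [rewrite ger0_norm|exact: Xbound].
- move=> u l u' l' e Wu Wu' hl hl' e0 hn.
  (* [phi] has determinant 1, so the determinant of the k-th matrix of [Psi u l] is (1 + l k)^d and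
     determines l k. *)
  have hdl k : `|l k - l' k| <= C * e.
    have /andP[l0 _] := hl k; have /andP[l0' _] := hl' k.
    have -> : l k - l' k = (1 + l k) - (1 + l' k) by ring.
    apply: le_trans (norm_subX_ge d.-1 _ _) _; rewrite ?lerDl // prednK //.
    rewrite -(detPsi u l k Wu) -(detPsi u' l' k Wu').
    by apply: hC => // i j; rewrite !mxE ?Psib //; apply: hn.
  have hX : entrywise_close ((1 + C * (b + h / 2)) * e) (X u) (X u').
    move=> k i j; have /andP[l0 _] := hl k.
    apply: (@le_trans _ _ (`|(1 + l k) * (X u k i j - X u' k i j)|)).
      by rewrite normrM ler_peMl // ger0_norm ?lerDl // addr_ge0.
    have -> : (1 + l k) * (X u k i j - X u' k i j) =
      (Psi u l k i j - Psi u' l' k i j) - (l k - l' k) * X u' k i j by rewrite /Psi; ring.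
    have -> : (1 + C * (b + h / 2)) * e = e + C * e * (b + h / 2) by ring.
    apply: le_trans (ler_normB _ _) _; apply: lerD; first exact: hn.
    rewrite normrM.
    by apply: ler_pM => //; exact: Xbound.
  have e' : 0 <= (1 + C * (b + h / 2)) * e.
    by rewrite mulr_ge0 // addr_ge0 // mulr_ge0 // ltW.
  have hphi := hK2 _ _ _ e' hX.
  have e'' : 0 <= K2 * ((1 + C * (b + h / 2)) * e) by rewrite mulr_ge0 // ltW.
  have hu := hK3 _ _ _ e'' (Wr1 u Wu) (Wr1 u' Wu') hphi.
  split=> [i j|k].
    rewrite ord1; apply: le_trans (hu j) _; rewrite !mulrA ler_wpM2r // -!mulrA.
    by rewrite lerDr ltW.
  by apply: le_trans (hdl k) _; rewrite ler_wpM2r // lerDl ltW.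
move=> u l s1 s2 Wu hl; rewrite /Psi (@slope_gap_scale _ _ _ _ _ (fun k => 1 + l k)).
  by rewrite (@slope_gap_scale _ _ _ _ _ (fun=> 1 + 0)) // => k; rewrite addr0 oner_eq0.
by move=> k; have /andP[l0 _] := hl k; rewrite gt_eqF // ltr_pwDl.
Qed.

End NullTheorems.

Theorem theorem1p2 (R : realType) (d m : nat) (V : 'M[R]_d) :
  (2 <= d)%N -> V \in unitmx -> (2 <= m)%N ->
  (* (i) *)
  leb_null [set M : 'M[R]_(m, d * d) | @Xset R d m V M /\ ~ strongly_diophantine (tup M)] /\
  leb_null [set M : 'M[R]_(m, d * d) |
             (forall i, tup M i \in unitmx /\ forall k l, 0 < tup M i k l) /\
             ~ strongly_diophantine (tup M)] /\
  (* (ii) *)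
  @SL_null R d m [set M | @Yset R d m V M /\ ~ strongly_diophantine (tup M)] /\
  @SL_null R d m [set M : 'M[R]_(m, d * d) |
             (forall i, \det (tup M i) = 1 /\ forall k l, 0 < tup M i k l) /\
             ~ strongly_diophantine (tup M)].
Proof.
move=> d2 uV m2; have m0 : (0 < m)%N by apply: ltnW.
(* The statements on positive entries are the case V = 1, where conjugation is trivial. *)
have u1 : (1%:M : 'M[R]_d) \in unitmx by apply: unitmx1.
have c1 (M : 'M[R]_(m, d * d)) k : conj_tup 1%:M M k = tup M k.
  by rewrite /conj_tup invmx1 mul1mx mulmx1.
have det_unit (A : 'M[R]_d) : \det A = 1 -> A \in unitmx.
  by move=> h; rewrite unitmxE h unitr1.
split; last split; last split.
- apply: leb_null_sub (not_strongly_diophantine_null d2 m0 uV) => M [hM nSD]; split => // k.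
  have [uA sA] := hM k; split => // i j; exact: strictly_preserves_positive.
- apply: leb_null_sub (not_strongly_diophantine_null d2 m0 u1) => M [hM nSD]; split => // k.
  by have [uA sA] := hM k; split => // i j; rewrite c1.
- move=> U phi Uo hSL hd hc.
  apply: leb_null_sub (not_strongly_diophantine_SL_null d2 m0 uV Uo hSL hd hc).
  move=> u [Uu [hM nSD]]; split => //; split => // k.
  have [dA sA] := hM k; split; first exact: det_unit.
  by move=> i j; exact: strictly_preserves_positive.
- move=> U phi Uo hSL hd hc.
  apply: leb_null_sub (not_strongly_diophantine_SL_null d2 m0 u1 Uo hSL hd hc).
  move=> u [Uu [hM nSD]]; split => //; split => // k.
  have [dA sA] := hM k; split; first exact: det_unit.
  by move=> i j; rewrite c1.
Qed.
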